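(* Let $D=D_1\,\#\,D_2\,\#\cdots\#\,D_m$ be a connected sum of diagrams, where each $D_i$ is a reduced alternating diagram of a prime link $L_i$, $i=1,\dots,m$. Let $Col^{red}(D)=\mathbb Z_{n_1}\oplus\mathbb Z_{n_2}\oplus\cdots\oplus\mathbb Z_{n_s}$ with $n_{i+1}\mid n_i$ for all $i$ and all $n_i>1$. Then: (a) for any pair of distinct arcs of $D$, both different from the arcs joining $D_i$ with $D_{i+1}$ ($1\le i<m$), there exists a Fox $n_1$-coloring of $D$ which distinguishes them, i.e. assigns them different colors; and (b) there are $t$ Fox $n_1$-colorings of $D$, for some $t\le s$, such that any pair of distinct arcs of $D$, both different from the arcs joining $D_i$ with $D_{i+1}$ ($1\le i<m$), is distinguished by one of these $t$ colorings.
   Context: Arcs of a link diagram are the segments running from undercrossing to undercrossing. A diagram is reduced if it has no nugatory crossing. Prime links are taken to be non-trivial and non-split. A Fox $k$-coloring of a diagram $D$ is a function $f$ from the arcs of $D$ to $\mathbb Z_k$ such that at each crossing with over-arc $b$ and under-arcs $a,c$ one has $2f(b)-f(a)-f(c)\equiv 0\pmod k$. $Col(D)$ is the abelian group generated by the arcs of $D$ with a relation $2b-a-c=0$ for each crossing ($b$ the over-arc, $a,c$ the under-arcs). $Col^{trivial}(D)\cong\mathbb Z$ is the group of trivial colorings, embedded in $Col(D)$, and $Col^{red}(D)=Col(D)/Col^{trivial}(D)$; it can be presented by adding to the presentation of $Col(D)$ the relation that one chosen arc is $0$. It is isomorphic to the first homology of the double cover of $S^3$ branched along the link, and is finite here.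 The connected sum of diagrams is the usual planar one: in each connected sum operation, each of the two diagrams is cut at a non-crossing point and the ends are joined by two parallel strands, so that a simple closed curve in the plane (or sphere) separates the two summands and meets the resulting diagram transversally in exactly two non-crossing points. The arcs joining $D_i$ with $D_{i+1}$ are the arcs of $D$ which run through these connecting strands, i.e. which meet one of the separating curves used in forming the connected sum. *)

(* Defs.v *)
From HB Require Import structures.
From mathcomp Require Import all_boot all_order all_algebra.
From mathcomp Require Import generic_quotient ring_quotient.
From mathcomp Require Import boolp.
From Stdlib Require List.
From Stdlib Require Import Relation_Operators.

Set Implicit Arguments.
Unset Strict Implicit.
Unset Printing Implicit Defensive.

Import GRing.Theory.

(* Unoriented link diagrams on the oriented sphere, as combinatorial maps.    *)
(* The darts are the half-edges of the underlying plane graph; edge d is the  *)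
(* other half of the edge of d, and node d is the next dart counterclockwise  *)
(* around the vertex of d.  A vertex has either four darts (a crossing) or    *)
(* two (a marked point, where nothing happens).  Marked points make it        *)
(* possible to represent components without crossings, and give the           *)
(* Reidemeister moves a uniform description.  over d says that d belongs to   *)
(* the over-strand of a crossing.  Connected components of the plane graph    *)
(* carry no relative position: all the ways of placing them on the sphere     *)
(* yield the same link up to isotopy, and the same arcs and crossings.        *)
Record diagram := Diagram {
  dart :> finType;
  edge : dart -> dart;
  node : dart -> dart;
  over : pred dart;
  dart_gt0 : 0 < #|dart|;
  edgeK : involutive edge;
  edge_neq : forall d, edge d != d;
  node_order4 : forall d, iter 4 node d = d;
  node_neq : forall d, node d != d;
  over_node : forall d, node (node d) != d -> over (node d) = ~~ over d;
  over_crossing : forall d, over d -> node (node d) != d;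
  (* Euler's formula V + F = E + 2 K, where K counts connected components;    *)
  (* the face orbits are those of edge \o node.                               *)
  planar :
    fcard node dart + fcard (fun d => edge (node d)) dart
    = fcard edge dart
      + 2 * n_comp [rel d d' | (d' == edge d) || (d' == node d)] dart
}.

Section DiagramTheory.
Variable D : diagram.
Implicit Types d : D.

Definition crossing d := node (node d) != d.

(* The orbit of d is the boundary of the face containing the corner that lies *)
(* between d and node d.                                                      *)
Definition face d := edge (node d).

Definition adj : rel D := [rel d d' | (d' == edge d) || (d' == node d)].

Definition connected : bool := n_comp adj D == 1.

(* A crossing is nugatory if some simple closed curve meets the diagram only  *)
(* there, going through two opposite corners: these lie in the same face.     *)
Definition reduced : Prop :=
  forall d, crossing d -> ~~ fconnect face d (node (node d)).

(* Walking along the diagram without going through a crossing.                *)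
Definition between_crossings : rel D :=
  [rel d d' | (d' == edge d) || ~~ crossing d && (d' == node d)].

Definition alternating : Prop :=
  forall d d', crossing d -> crossing d' -> d != d' ->
    connect between_crossings d d' -> over d' = ~~ over d.

(* Walking along the diagram without going through an undercrossing.          *)
Definition along_arc : rel D :=
  [rel d d' | [|| d' == edge d,
                  ~~ crossing d && (d' == node d)
                | over d && (d' == node (node d))]].

Definition arc_set d : {set D} := [set d' | connect along_arc d d'].

Definition Arc := {A : {set D} | A \in [set arc_set d | d : D]}.

Fact arc_set_in d : arc_set d \in [set arc_set d | d : D].
Proof. exact: imset_f. Qed.

Definition arc_at d : Arc := exist _ (arc_set d) (arc_set_in d).

(* At the crossing of an over dart d, the over-arc is that of d, and the two  *)
(* under-arcs are those of the darts next to d on either side.                *)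
Definition fox_coloring k (f : Arc -> 'I_k) : Prop :=
  forall d, over d ->
    2 * f (arc_at d)
    = f (arc_at (node d)) + f (arc_at (node (node (node d)))) %[mod k].

End DiagramTheory.

(* D' is D with a new marked point m inserted in the middle of an edge.       *)
Definition subdivides (D D' : diagram) : Prop :=
  exists (h : D -> D') (m : D'),
    [/\ ~~ crossing m, edge m != node m, injective h,
        forall d', d' \in codom h = (d' \notin [:: m; node m]) &
        forall d, [/\ h (node d) = node (h d), over d = over (h d) &
          h (edge d) = let e := edge (h d) in
                       if e \in [:: m; node m] then edge (node e) else e]].

(* D' is obtained from D by replacing one tangle by another.  The vertices of *)
(* the old tangle are those of the darts in ends ++ inner, where inner is a   *)
(* union of edges of the tangle, while the darts in ends point to its         *)
(* boundary; ends' lists the darts taking their place.                        *)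
Definition replaces (D : diagram) (ends inner : seq D)
                    (D' : diagram) (ends' inner' : seq D') : Prop :=
  [/\ uniq (ends ++ inner), uniq (ends' ++ inner') &
  exists h : D -> D',
    [/\ {in [predC inner] &, injective h},
        forall d', d' \notin inner' <-> exists2 d, d \notin inner & h d = d',
        [seq h d | d <- ends] = ends',
        {in [predC inner], forall d, h (edge d) = edge (h d)} &
        {in [predC ends ++ inner], forall d,
           h (node d) = node (h d) /\ over d = over (h d)}]].

Definition isomorphic (D D' : diagram) : Prop :=
  @replaces D [::] [::] D' [::] [::].

Definition reidemeister1 (D D' : diagram) : Prop :=
  exists (m : D) (x : D'),
    [/\ ~~ crossing m, edge x = node x &
        replaces [:: m; node m] [::]
                 [:: node (node x); node (node (node x))] [:: x; node x]].

(* The two crossings of D' bound a bigon, whose corners are at x and y, and   *)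
(* the same strand is above at both of them.  That the two strands of D can   *)
(* be brought together is ensured by the planarity of D'.                     *)
Definition reidemeister2 (D D' : diagram) : Prop :=
  exists (m1 m2 : D) (x y : D'),
    [/\ ~~ crossing m1 && ~~ crossing m2,
        edge x = node y /\ edge y = node x,
        over (node x) = over y &
        replaces [:: m1; node m1; m2; node m2] [::]
                 [:: node (node (node x)); node (node y);
                     node (node x); node (node (node y))]
                 [:: x; node x; y; node y]].

(* Both triangles have their corners at x, y, z, in counterclockwise order.   *)
(* The strand through x and node y is above, or below, at both of its         *)
(* crossings iff over x != over y, and similarly for the other two strands;   *)
(* hence there are a top, a middle and a bottom strand unless over takes the  *)
(* same value at x, y and z.                                                  *)
Definition reidemeister3 (D D' : diagram) : Prop :=
  exists (x y z : D) (x' y' z' : D'),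
    [/\ [/\ edge x = node y, edge y = node z & edge z = node x],
        [/\ edge x' = node y', edge y' = node z' & edge z' = node x'],
        [/\ over x' = over x, over y' = over y & over z' = over z],
        ~~ ((over x == over y) && (over y == over z)) &
        replaces [:: node (node x); node (node (node x));
                     node (node y); node (node (node y));
                     node (node z); node (node (node z))]
                 [:: x; node x; y; node y; z; node z]
                 [:: node (node (node y')); node (node z');
                     node (node (node z')); node (node x');
                     node (node (node x')); node (node y')]
                 [:: x'; node x'; y'; node y'; z'; node z']].

Definition reidemeister_move (D D' : diagram) : Prop :=
  [\/ isomorphic D D' \/ subdivides D D',
      reidemeister1 D D', reidemeister2 D D' | reidemeister3 D D'].

(* Two diagrams represent the same (unoriented) link.                         *)
Definition same_link : diagram -> diagram -> Prop :=
  clos_refl_sym_trans diagram reidemeister_move.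

(* D is made of A and B, where the edges {a, edge a} of A and {b, edge b} of  *)
(* B have been cut and their ends joined by two strands.                      *)
Definition joins (A B D : diagram) (f : A -> D) (g : B -> D) (a : A) (b : B)
    : Prop :=
  [/\ injective f /\ injective g,
      forall d, (d \in codom f) = (d \notin codom g),
      (forall x, node (f x) = f (node x) /\ over (f x) = over x) /\
      (forall y, node (g y) = g (node y) /\ over (g y) = over y),
      (forall x, x \notin [:: a; edge a] -> edge (f x) = f (edge x)) /\
      (forall y, y \notin [:: b; edge b] -> edge (g y) = g (edge y)) &
      edge (f a) = g b /\ edge (f (edge a)) = g (edge b)].

Definition trivial_knot (D : diagram) : Prop :=
  exists U : diagram,
    [/\ same_link D U, connected U & forall d : U, ~~ crossing d].

Definition split_link (D : diagram) : Prop :=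
  exists E : diagram, same_link D E /\ ~~ connected E.

(* The link represented by D is prime.                                        *)
Definition prime_link (D : diagram) : Prop :=
  [/\ ~ trivial_knot D, ~ split_link D &
      forall (A B E : diagram) (f : A -> E) (g : B -> E) (a : A) (b : B),
        same_link D E -> joins f g a b -> trivial_knot A \/ trivial_knot B].

(* connected_sum D Ds J: D is an iterated connected sum of the diagrams Ds    *)
(* (in any bracketing, and at any edges), and J is the set of the darts of    *)
(* those edges of D which meet one of the separating curves.                  *)
Inductive connected_sum : forall D : diagram, seq diagram -> {set D} -> Prop :=
| ConnectedSum1 D : @connected_sum D [:: D] set0
| ConnectedSum2 (A B D : diagram) (As Bs : seq diagram)
    (JA : {set A}) (JB : {set B}) (f : A -> D) (g : B -> D) (a : A) (b : B) :
    connected_sum As JA -> connected_sum Bs JB -> joins f g a b ->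
    connected_sum (As ++ Bs)
      (f @: JA :|: g @: JB :|: [set f a; g b; f (edge a); g (edge b)]).

Definition joining_arc (D : diagram) (J : {set D}) (a : Arc D) : bool :=
  [exists d in J, a == arc_at d].

Section AbelianGroups.
Local Open Scope ring_scope.
Local Open Scope quotient_scope.

Definition int_span (V : zmodType) (I : finType) (r : I -> V) : {pred V} :=
  fun v => `[< exists c : I -> int, v = \sum_i r i *~ c i >].

Fact int_span_zmod_closed (V : zmodType) (I : finType) (r : I -> V) :
  zmod_closed (int_span r).
Proof.
split=> [|u v /asboolP[cu ->] /asboolP[cv ->]]; apply/asboolP.
  by exists (fun=> 0); rewrite big1.
exists (fun i => cu i - cv i); rewrite -sumrB.
by apply: eq_bigr => i _; rewrite mulrzBr.
Qed.

HB.instance Definition _ (V : zmodType) (I : finType) (r : I -> V) :=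
  GRing.isZmodClosed.Build V (int_span r) (int_span_zmod_closed r).

(* The quotient of V by the subgroup generated by the family r.               *)
Definition quotient_by (V : zmodType) (I : finType) (r : I -> V) : zmodType :=
  Quotient.quot (int_span r).

Definition class_by (V : zmodType) (I : finType) (r : I -> V) (v : V)
    : quotient_by r := \pi_(Quotient.quot (int_span r)) v.

(* Z_n1 (+) ... (+) Z_ns; it is meant for ni > 1, as 'Z_1 is not Z / 1Z.      *)
Fixpoint cyclic_sum (ns : seq nat) : zmodType :=
  if ns is n :: ns' then ('Z_n * cyclic_sum ns')%type else 'I_1.

Definition group_isomorphic (G H : zmodType) : Prop :=
  exists phi : {additive G -> H}, bijective phi.

Variable D : diagram.

Definition arc_gen (a : Arc D) : {ffun Arc D -> int} :=
  [ffun a' => (a' == a)%:R].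

Definition crossing_relation (d : {d : D | over d}) : {ffun Arc D -> int} :=
  arc_gen (arc_at (val d)) *+ 2 - arc_gen (arc_at (node (val d)))
  - arc_gen (arc_at (node (node (node (val d))))).

Definition Col : zmodType := quotient_by crossing_relation.

Definition Col_gen (a : Arc D) : Col := class_by crossing_relation (arc_gen a).

(* Col^trivial is embedded in Col as the subgroup generated by the class of   *)
(* one chosen arc a0; other choices give isomorphic quotients.                *)
Definition Col_red (a0 : Arc D) : zmodType :=
  quotient_by (fun _ : unit => Col_gen a0).

End AbelianGroups.

(* Main.v *)
From HB Require Import structures.
From mathcomp Require Import all_boot all_order all_algebra all_fingroup.
From mathcomp Require Import generic_quotient ring_quotient boolp zify.
From Stdlib Require List.
From Stdlib Require Import Relation_Operators.
Require Import Defs.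

Set Implicit Arguments.
Unset Strict Implicit.
Unset Printing Implicit Defensive.

(** The theorem comes down to the fact that two distinct arcs of [D], one of
    which avoids the connecting strands, are different elements of [Col D].
    Arcs that are equal modulo a chosen arc are equal in [Col D]
    ([Col_red_inj]), so the difference of two such arcs then has a nonzero
    coordinate in some summand Z / ni of the reduced group; as ni divides n1,
    this coordinate is a coloring modulo n1 that distinguishes the two arcs, and
    the s coordinates distinguish all of them.

    For one reduced alternating diagram of a prime link the argument is a
    maximum principle.  An equality between arcs a and b in [Col D] is an
    integral combination of the relations, that is a weight for each crossing.
    In an alternating diagram each arc passes above exactly one crossing, and
    the equality says that the weight of a crossing is the mean of the weights
    of the two crossings at the ends of its over-arc, with an error at the
    crossings of a and b only ([alternating_balance]).  Direct each edge of the
    underlying 4-valent graph from its upper to its lower end.  The set of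
    crossings of maximal weight contains the crossing of a but not that of b,
    and exactly one edge leaves it ([balance_level]).  As two edges leave each
    crossing and two enter it, exactly one edge enters this set too: it is
    joined to the rest of the diagram by two edges, which presents [D] as a
    connected sum of two diagrams A and B ([outs_cut], [side_exists]).

    Since the link is prime, A or B represents the trivial knot, so all its
    colorings are constant, by invariance under Reidemeister moves
    ([trivial_knot_only_constant]).  But A and B are again connected, reduced and
    alternating and have crossings, and such a diagram has a nonconstant
    coloring ([alternating_nontrivial]): otherwise the maximum principle applies
    to any two of its arcs, and a smallest set of crossings left by at most one
    edge is reduced by submodularity to a single crossing, which is nugatory.

    That A and B are plane diagrams, and that they are reduced, rests on Euler's
    formula: the genus of a combinatorial map is nonnegative ([genus_ge0]), so
    that no edge of a connected diagram has the same face on both sides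
    ([face_edge]) and the two edges of a cut border two common faces ([cut_face]).

    Finally, the statement about [Col D] passes to connected sums because a
    coloring of a summand extends by a constant ([sum_arcs_distinct]). *)

(** * Counting the cycles of permutations *)

Section OrbitCounting.
Variable T : finType.
Implicit Types (s t : {perm T}) (x y z : T).

Lemma porbit_fconnect s x y : (y \in porbit s x) = fconnect s x y.
Proof.
apply/porbitP/idP => [[i ->]|/iter_findex <-].
  by rewrite permX fconnect_iter.
by exists (findex s x y); rewrite permX.
Qed.

Lemma card_porbits s : #|porbits s| = fcard s T.
Proof.
have symf := fconnect_sym (@perm_inj _ s).
pose F x := porbit s x.
rewrite /n_comp_mem -(@card_in_imset _ _ F [predI froots s & T]).
  apply: eq_card => A; apply/imsetP/imsetP => [[x _ ->]|[x _ ->]]; last first.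
    by exists x; rewrite ?inE.
  exists (froot s x); first by rewrite !inE roots_root.
  by apply/eqP; rewrite eq_porbit_mem porbit_sym porbit_fconnect connect_root.
move=> x y /andP[/eqP rx _] /andP[/eqP ry _] /eqP.
rewrite eq_porbit_mem porbit_fconnect => /(fingraph.rootP symf) e.
by rewrite -rx -ry -e.
Qed.

Lemma porbits_mulr_tperm s x y :
  #|porbits (s * tperm x y)| + (x \notin porbit s y).*2
  = #|porbits s| + (x != y).
Proof.
have := porbits_mul_tperm s^-1 x y; rewrite /= porbitV porbitsV => <-.
by rewrite -porbitsV invMg tpermV.
Qed.

End OrbitCounting.

Section Genus.
Variable T : finType.
Implicit Types (f g : T -> T) (s t : {perm T}) (x y z : T).

Definition step2 f g : rel T := [rel x y | (y == f x) || (y == g x)].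

Lemma step2_sym f g : injective f -> injective g -> connect_sym (step2 f g).
Proof.
move=> injf injg x y.
have E : connect (step2 f g) =2 connect (relU (frel f) (frel g)).
  by apply: eq_connect => u v; rewrite /= ![_ == v]eq_sym.
by rewrite !E relU_sym // => u v; rewrite fconnect_sym.
Qed.

Lemma step2_connectl f g x : connect (step2 f g) x (f x).
Proof. by apply: connect1; rewrite /step2 /= eqxx. Qed.

Lemma step2_connectr f g x : connect (step2 f g) x (g x).
Proof. by apply: connect1; rewrite /step2 /= eqxx orbT. Qed.

(** One new link merges at most one pair of components: the roots of [e] other
    than that of [y] stay in different components of [e2]. *)
Lemma n_comp_link (e e2 : rel T) x y :
    connect_sym e -> connect_sym e2 ->
    (forall u v, e2 u v ->
       [\/ connect e u v, connect e u x && connect e y v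
         | connect e u y && connect e x v]) ->
  n_comp e T <= n_comp e2 T + ~~ connect e x y.
Proof.
move=> sym_e sym_e2 link.
have {}link u v : connect e2 u v ->
   [\/ connect e u v, connect e u x && connect e y v
     | connect e u y && connect e x v].
  move=> /connectP[p p_path ->]; elim: p u p_path => [|w p IHp] u /=.
    by rewrite connect0; constructor.
  case/andP=> /link uw /IHp{IHp}; set z := last w p.
  case: uw => [uw|/andP[ux yw]|/andP[uy xw]];
    case=> [wz|/andP[wx yz]|/andP[wy xz]].
  - by constructor 1; apply: connect_trans wz.
  - by constructor 2; rewrite yz (connect_trans uw).
  - by constructor 3; rewrite xz (connect_trans uw).
  - by constructor 2; rewrite ux (connect_trans yw).
  - by constructor 2; rewrite ux yz.
  - by constructor 1; apply: connect_trans xz.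
  - by constructor 3; rewrite uy (connect_trans xw).
  - by constructor 1; apply: connect_trans yz.
  - by constructor 3; rewrite uy xz.
have [xy|xNy] := boolP (connect e x y).
  rewrite addn0 /n_comp_mem.
  rewrite -(@card_in_imset _ _ (fingraph.root e2) [predI roots e & T]).
    apply: subset_leq_card; apply/subsetP=> _ /imsetP[u _ ->].
    by rewrite !inE roots_root.
  move=> u v /andP[/eqP ru _] /andP[/eqP rv _] /(fingraph.rootP sym_e2) /link uv.
  rewrite -ru -rv; apply/(fingraph.rootP sym_e); case: uv => // /andP[ux yv].
    exact: connect_trans (connect_trans ux xy) yv.
  by apply: connect_trans (connect_trans ux _) yv; rewrite sym_e.
rewrite addn1 /n_comp_mem (cardD1 (fingraph.root e y)) !inE roots_root //.
rewrite add1n ltnS.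
rewrite -(@card_in_imset _ _ (fingraph.root e2)).
  apply: subset_leq_card; apply/subsetP=> _ /imsetP[u _ ->].
  by rewrite !inE roots_root.
move=> u v; rewrite !inE => /and3P[uNy /eqP ru _] /and3P[vNy /eqP rv _].
move=> /(fingraph.rootP sym_e2) /link uv.
rewrite -ru -rv; apply/(fingraph.rootP sym_e); case: uv => // /andP[uw wv].
  by case/negP: vNy; rewrite eq_sym -rv root_connect.
by case/negP: uNy; rewrite eq_sym -ru root_connect // sym_e.
Qed.

Lemma n_comp_step2_id f : injective f -> n_comp (step2 id f) T = fcard f T.
Proof.
move=> injf; apply: eq_n_comp => x y; apply/idP/idP.
  apply: connect_sub => {x y} x y /= /orP[] /eqP->; first exact: connect0.
  exact: fconnect1.
apply: connect_sub => {x y} x y /= /eqP<-; exact: step2_connectr.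
Qed.

(** The genus of a combinatorial map is nonnegative.  The permutation [s] is
    undone by one transposition at a time: each one splits a cycle of [s]; when
    it also splits a component, it has to split a cycle of [s * t], as the
    cycles of [s * t] lie inside the components. *)
Lemma genus_ge0_perm s t :
  #|porbits s| + #|porbits t| + #|porbits (s * t)|
  <= #|T| + (n_comp (step2 s t) T).*2.
Proof.
have [n] := ubnP #|[set x | s x != x]|; elim: n s => // n IHn s le_n.
have [/eqP s_id|] := boolP ([set x | s x != x] == set0).
  have -> : s = 1%g.
    apply/permP=> x; rewrite perm1; apply/eqP.
    by have := in_set0 x; rewrite -s_id inE => /negbFE.
  rewrite mul1g !card_porbits (eq_fcard (f' := id)); last by move=> x; rewrite perm1.
  rewrite fcard_id (@eq_n_comp _ (step2 (1%g : {perm T}) t) (step2 id t)).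
    rewrite n_comp_step2_id; last exact: perm_inj.
    by rewrite -addnn addnA.
  by apply: eq_connect => x y; rewrite /step2 /= (perm1 x).
case/set0Pn=> x; rewrite inE => sxNx; pose y := s x.
pose s' := (tperm x y * s)%g.
have s'x : s' x = s y by rewrite permM tpermL.
have s'y : s' y = y by rewrite permM tpermR.
have s'z z : z != x -> z != y -> s' z = s z.
  by move=> zx zy; rewrite permM tpermD // eq_sym.
have {}/IHn IH : #|[set z | s' z != z]| < n.
  rewrite -ltnS; apply: leq_trans le_n; rewrite ltnS; apply: proper_card.
  rewrite properE; apply/andP; split; last first.
    apply/negP=> /subsetP /(_ y).
    by rewrite !inE s'y eqxx (inj_eq perm_inj) sxNx => /(_ isT).
  apply/subsetP=> z; rewrite !inE.
  have [-> //|zx] := eqVneq z x.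
  have [->|zy] := eqVneq z y; first by rewrite s'y eqxx.
  by rewrite s'z.
have orb_s' := porbits_mul_tperm s x y.
rewrite /= -/s' porbit_sym [y \in _](mem_porbit s 1) in orb_s'.
rewrite [x == y]eq_sym sxNx addn0 in orb_s'.
have orb_st := porbits_mul_tperm (s' * t) x y.
have {}orb_st : #|porbits (s * t)| + (x \notin porbit (s' * t) y).*2
    = #|porbits (s' * t)| + 1.
  by rewrite /= mulgA /s' mulgA tperm2 mul1g [x == y]eq_sym sxNx in orb_st.
have sym' := step2_sym (@perm_inj _ s') (@perm_inj _ t).
have sym := step2_sym (@perm_inj _ s) (@perm_inj _ t).
have link : n_comp (step2 s' t) T
    <= n_comp (step2 s t) T + ~~ connect (step2 s' t) x y.
  apply: n_comp_link => // u v /= /orP[] /eqP->; last first.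
    by constructor 1; apply: step2_connectr.
  have [->|ux] := eqVneq u x; first by constructor 2; rewrite !connect0.
  have [->|uy] := eqVneq u y.
    by constructor 3; rewrite connect0 -s'x step2_connectl.
  by constructor 1; rewrite -s'z //; apply: step2_connectl.
have st_conn : x \in porbit (s' * t) y -> connect (step2 s' t) x y.
  rewrite porbit_fconnect sym' => /connect_sub; apply=> u v /= /eqP<-.
  rewrite permM; apply: connect_trans (step2_connectl _ _ _) _.
  exact: step2_connectr.
have arith (a b c d f m k k' : nat) : a + b + c <= m + k'.*2 -> a = f + 1 ->
    d + 1.*2 = c + 1 -> k' <= k + 1 -> f + b + d <= m + k.*2 by lia.
have arith' (a b c d f m k k' : nat) : a + b + c <= m + k'.*2 -> a = f + 1 ->
    d + 0.*2 = c + 1 -> k' <= k + 0 -> f + b + d <= m + k.*2 by lia.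
move: orb_st link; case: (boolP (x \in _)) => [/st_conn ->|_].
  exact: arith' IH orb_s'.
move=> orb_st link; apply: arith IH orb_s' orb_st _.
by apply: leq_trans link _; rewrite leq_add2l leq_b1.
Qed.

Lemma genus_ge0 f g : injective f -> injective g ->
  fcard f T + fcard g T + fcard (g \o f) T <= #|T| + (n_comp (step2 f g) T).*2.
Proof.
move=> injf injg; have := genus_ge0_perm (perm injf) (perm injg).
rewrite !card_porbits (eq_fcard (permE injf)) (eq_fcard (permE injg)).
rewrite (@eq_fcard _ (perm injf * perm injg)%g (g \o f)).
  rewrite (@eq_n_comp _ (step2 (perm injf) (perm injg)) (step2 f g)) //.
  by apply: eq_connect => x y; rewrite /step2 /= (permE injf x) (permE injg x).
by move=> x; rewrite permM !permE.
Qed.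

End Genus.

(** * Darts, vertices and faces *)

Lemma fcard_tperm (T : finType) (f : T -> T) (x y : T) : injective f ->
  fcard (tperm x y \o f) T + (~~ fconnect f x y).*2 = fcard f T + (x != y).
Proof.
move=> injf; have := porbits_mulr_tperm (perm injf) x y.
rewrite !card_porbits (eq_fcard (permE injf)) porbit_sym porbit_fconnect.
rewrite (eq_fconnect (permE injf)) => <-; congr (_ + _).
by apply: eq_fcard => z; rewrite permM (permE injf).
Qed.

Lemma even_fpf (T : finType) (f : T -> T) (A : {set T}) :
    involutive f -> (forall x, x \in A -> f x \in A) ->
    (forall x, x \in A -> f x != x) ->
  fcard f A * 2 = #|A|.
Proof.
move=> fK fA fpf; apply: fcard_order_set.
- exact: inv_inj fK.
- apply/subsetP=> x xA; rewrite inE; apply/eqP.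
  apply: (@order_cycle _ _ [:: x; f x]); rewrite ?inE ?eqxx //=.
    by rewrite fK !eqxx.
  by rewrite inE eq_sym fpf.
apply: intro_closed; first by apply: fconnect_sym; apply: inv_inj fK.
by move=> x y /eqP<-; apply: fA.
Qed.

Lemma even_card_fpf (T : finType) (f : T -> T) (A : {set T}) :
    involutive f -> (forall x, x \in A -> f x \in A) ->
    (forall x, x \in A -> f x != x) -> ~~ odd #|A|.
Proof. by move=> fK fA fpf; rewrite -(even_fpf fK fA fpf) oddM andbF. Qed.

Lemma n_comp_eq1 (T : finType) (e : rel T) (x : T) :
  connect_sym e -> (forall y, connect e x y) -> n_comp e T = 1.
Proof.
move=> sym_e xT; rewrite -(n_comp_connect sym_e x).
by apply: eq_n_comp_r => y; rewrite [RHS]xT.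
Qed.

Section Basics.
Variable D : diagram.
Implicit Types d x y z p q : D.

Lemma node4 d : node (node (node (node d))) = d.
Proof. exact: (node_order4 d). Qed.

Lemma edge_inj : injective (@edge D).
Proof. exact: (can_inj (@edgeK D)). Qed.

Lemma node_inj : injective (@node D).
Proof.
by apply: (can_inj (g := fun d => node (node (node d)))) => d; apply: node4.
Qed.

Lemma face_inj : injective (@face D).
Proof. by move=> x y /edge_inj /node_inj. Qed.

Lemma crossing_node d : crossing (node d) = crossing d.
Proof. by rewrite /crossing (inj_eq node_inj). Qed.

Lemma marked_node2 d : ~~ crossing d -> node (node d) = d.
Proof. by move=> /negbNE/eqP. Qed.

Lemma over_node1 d : crossing d -> over (node d) = ~~ over d.
Proof. exact: over_node. Qed.

Lemma over_node2 d : crossing d -> over (node (node d)) = over d.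
Proof. by move=> cd; rewrite !over_node1 ?crossing_node ?negbK. Qed.

Lemma over_node3 d : crossing d -> over (node (node (node d))) = ~~ over d.
Proof. by move=> cd; rewrite over_node1 ?over_node2 ?crossing_node. Qed.

Lemma adj_sym : connect_sym (adj (D := D)).
Proof. exact: step2_sym edge_inj node_inj. Qed.

Lemma connectedP x y : connected D -> connect (adj (D := D)) x y.
Proof.
move=> /eqP conn; rewrite -(root_connect adj_sym).
have /card_le1_eqP le1 : #|[predI roots (adj (D := D)) & D]| <= 1.
  by move: conn; rewrite /n_comp_mem => ->.
by apply/eqP; apply: le1; rewrite !inE roots_root //; apply: adj_sym.
Qed.

Lemma connected_ind (P : pred D) x :
    connected D -> P x ->
    (forall y, P y -> P (edge y)) -> (forall y, P y -> P (node y)) ->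
  forall y, P y.
Proof.
move=> conn Px Pe Pn y.
have clP : closed (adj (D := D)) P.
  apply: (intro_closed adj_sym) => u v /orP[] /eqP->; [exact: Pe|exact: Pn].
by move: (closed_connect clP (connectedP x y conn)); rewrite !unfold_in Px => <-.
Qed.

Lemma fcard_edge2 : fcard (@edge D) D * 2 = #|D|.
Proof.
rewrite (@eq_n_comp_r _ _ D [set: D]); last by move=> x; rewrite !inE.
rewrite even_fpf ?cardsT // => [|x _]; [exact: edgeK|exact: edge_neq].
Qed.

(** The dart opposite to [d] at its vertex.  This involution without fixed
    points makes every vertex even, whence the parity arguments below. *)
Definition through d := if crossing d then node (node d) else node d.

Lemma throughK : involutive through.
Proof.
move=> d; rewrite /through; case: (boolP (crossing d)) => cd.
  by rewrite !crossing_node cd node4.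
by rewrite crossing_node (negbTE cd) marked_node2.
Qed.

Lemma through_neq d : through d != d.
Proof. by rewrite /through; case: ifP => // _; apply: node_neq. Qed.

Lemma euler_connected : connected D ->
  fcard (@node D) D + fcard (@edge D) D + fcard (@face D) D = #|D| + 2.
Proof.
move=> /eqP conn; have := planar D; rewrite -fcard_edge2.
rewrite -/(adj (D := D)) conn /face => pl.
by rewrite addnAC pl muln1 muln2 -addnn addnAC.
Qed.

(** An edge with the same face on both sides is a bridge: removing it splits
    this face, so the genus would become negative unless a component splits as
    well.  But vertices have even degree, so there is no bridge: the component
    of one end of a removed bridge would contain an odd number of darts, all but
    one of them being paired by the edges. *)
Lemma face_edge p : connected D -> ~~ fconnect (@face D) p (edge p).
Proof.
move=> conn; apply/negP => pq; set q := edge p in pq.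
(* the edges after [p] and [q] have been disconnected from each other *)
pose e1 := tperm p q \o @edge D.
have e1_inj : injective e1 by move=> x y /perm_inj /edge_inj.
have pNq : p != q by rewrite eq_sym edge_neq.
have e1z z : z != p -> z != q -> e1 z = edge z.
  move=> zp zq; rewrite /e1 /= tpermD //.
    by rewrite -(inj_eq edge_inj) edgeK eq_sym.
  by rewrite (inj_eq edge_inj) eq_sym.
have e1p : e1 p = p by rewrite /e1 /= tpermR.
have e1q : e1 q = q by rewrite /e1 /= edgeK tpermL.
have sym1 := step2_sym node_inj e1_inj.
pose C := [set x | connect (step2 (@node D) e1) p x].
have pC : p \in C by rewrite inE connect0.
have nC x : x \in C -> node x \in C.
  by rewrite !inE => px; apply: connect_trans px (step2_connectl _ _ _).
have eC x : x \in C -> e1 x \in C.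
  by rewrite !inE => px; apply: connect_trans px (step2_connectr _ _ _).
have qC : q \in C.
  apply: contraT => qNC.
  have evenC : ~~ odd #|C|.
    apply: (@even_card_fpf _ through) => [|x xC|x _]; first exact: throughK.
      by rewrite /through; case: ifP => _; rewrite ?nC.
    exact: through_neq.
  have: ~~ odd #|C :\ p|.
    apply: (@even_card_fpf _ (@edge D)) => [|x|x _]; first exact: edgeK.
      rewrite !in_setD1 => /andP[xp xC].
      have xq : x != q by apply: contraNneq qNC => <-.
      by rewrite -(inj_eq edge_inj) edgeK xq -e1z ?eC.
    exact: edge_neq.
  by move: evenC; rewrite (cardsD1 p) pC add1n /= negbK => ->.
have CT x : x \in C.
  apply: (connected_ind (P := fun x => x \in C) conn pC _ nC x) => y yC.
  have [->|yp] := eqVneq y p; first exact: qC.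
  have [->|yq] := eqVneq y q; first by rewrite /q edgeK.
  by rewrite -e1z ?eC.
have K1 : n_comp (step2 (@node D) e1) D = 1.
  by apply: (n_comp_eq1 (x := p)) => // y; have := CT y; rewrite inE.
have := genus_ge0 node_inj e1_inj; rewrite K1.
have := fcard_tperm p q edge_inj; rewrite fconnect1 pNq.
have := fcard_tperm p q face_inj; rewrite pq pNq.
have -> : fcard (e1 \o @node D) D = fcard (tperm p q \o @face D) D by [].
have := euler_connected conn; rewrite -/e1 /=; lia.
Qed.

End Basics.

(** * Two-edge cuts of a diagram *)

Section SubMap.
Variables (T : finType) (S : {set T}).
Local Notation TS := {x : T | x \in S}.

Lemma n_comp_sub (e : rel T) (e' : rel TS) :
    connect_sym e -> connect_sym e' ->
    (forall x y, e x y -> x \in S -> y \in S) ->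
    (forall x y, e' x y = e (val x) (val y)) ->
  n_comp e' {: TS} = n_comp e S.
Proof.
move=> sym_e sym_e' clS e'E.
have clS' : closed e S by apply: intro_closed clS.
have -> : n_comp e S = n_comp e' [preim val of S].
  apply: adjunction_n_comp => //; apply: strict_adjunction => //.
  - exact: val_inj.
  - apply/subsetP=> x xS; apply/codomP; exists (exist _ x xS); by [].
by apply: eq_n_comp_r => x; rewrite !inE (valP x).
Qed.

Variable (f : T -> T).
Hypothesis fS : forall x, x \in S -> f x \in S.

Definition sub_fun (x : TS) : TS := exist _ (f (val x)) (fS (valP x)).

Lemma sub_fun_inj : injective f -> injective sub_fun.
Proof. by move=> injf x y [/injf xy]; apply: val_inj. Qed.

Lemma fcard_sub : injective f -> fcard sub_fun {: TS} = fcard f S.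
Proof.
move=> injf; apply: n_comp_sub => //.
- by move=> x y; apply: fconnect_sym.
- by move=> x y; apply: fconnect_sym; apply: sub_fun_inj.
- by move=> x y /eqP<-; apply: fS.
Qed.

End SubMap.

Lemma n_comp_step2_sub (T : finType) (S : {set T}) (f g : T -> T)
    (fS : forall x, x \in S -> f x \in S)
    (gS : forall x, x \in S -> g x \in S) :
    injective f -> injective g ->
  n_comp (step2 (sub_fun fS) (sub_fun gS)) {: {x | x \in S}}
  = n_comp (step2 f g) S.
Proof.
move=> injf injg; apply: n_comp_sub => //.
- exact: step2_sym.
- by apply: step2_sym; apply: sub_fun_inj.
- by move=> x y /orP[] /eqP-> ?; [apply: fS|apply: gS].
Qed.

Lemma genus_ge0_in (T : finType) (S : {set T}) (f g : T -> T) :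
    injective f -> injective g ->
    (forall x, x \in S -> f x \in S) -> (forall x, x \in S -> g x \in S) ->
  fcard f S + fcard g S + fcard (g \o f) S <= #|S| + (n_comp (step2 f g) S).*2.
Proof.
move=> injf injg fS gS.
have gfS x : x \in S -> (g \o f) x \in S by move=> xS; apply/gS/fS.
rewrite -(fcard_sub fS) // -(fcard_sub gS) // -(fcard_sub gfS); last first.
  exact: inj_comp.
rewrite -(n_comp_step2_sub fS gS) // -[#|S|]card_sig.
have := genus_ge0 (sub_fun_inj (fS := fS) injf) (sub_fun_inj (fS := gS) injg).
by congr (_ + _ <= _); apply: eq_fcard => x; apply: val_inj.
Qed.

Lemma fconnect_return (T : finType) (f : T -> T) (A : {set T}) x :
    injective f -> x \in A -> f x \notin A ->
  exists2 y, fconnect f (f x) y & (y \notin A) && (f y \in A).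
Proof.
move=> injf xA fxA; have [/existsP[y]|no_y] :=
    boolP [exists y, fconnect f (f x) y && ((y \notin A) && (f y \in A))].
  by case/andP=> ? ?; exists y.
suff : x \notin A by rewrite xA.
have : fconnect f (f x) x by rewrite fconnect_sym // fconnect1.
move=> /iter_findex <-; elim: (findex _ _) => [|n IHn] //=.
apply: contra no_y => fA; apply/existsP; exists (iter n f (f x)).
by rewrite fconnect_iter IHn.
Qed.

Section Cut.
Variable D : diagram.
Implicit Types (S : {set D}) (p x y z : D).

(** A set of vertices, given by their darts, that is joined to the rest of the
    diagram by the two edges at [p] and [p'] only. *)
Record cut S p p' : Prop := Cut {
  cut_node : forall x, x \in S -> node x \in S;
  cut_in : p \in S;
  cut_in' : p' \in S;
  cut_neq : p != p';
  cut_out : edge p \notin S;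
  cut_out' : edge p' \notin S;
  cut_edge : forall x, x \in S -> x != p -> x != p' -> edge x \in S }.

Lemma cut_nodeE S p p' x : cut S p p' -> (node x \in S) = (x \in S).
Proof.
move=> cS; apply/idP/idP; last exact: (cut_node cS).
by do 3!move=> /(cut_node cS); rewrite node4.
Qed.

Lemma cut_sym S p p' : cut S p p' -> cut S p' p.
Proof.
case=> nS pS p'S pp' qS q'S eS; split=> //; first by rewrite eq_sym.
by move=> x xS xp' xp; apply: eS.
Qed.

Lemma cutC S p p' : cut S p p' -> cut (~: S) (edge p) (edge p').
Proof.
move=> cS; split; rewrite ?inE ?edgeK ?(inj_eq (@edge_inj D)) ?negbK.
- by move=> x; rewrite !inE (cut_nodeE _ cS).
- exact: cut_out cS.
- exact: cut_out' cS.
- exact: cut_neq cS.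
- exact: cut_in cS.
- exact: cut_in' cS.
- move=> x; rewrite !inE => xS xq xq'; apply: contra xS => exS.
  rewrite -(edgeK x); apply: (cut_edge cS) => //.
    by rewrite -(inj_eq (@edge_inj D)) edgeK.
  by rewrite -(inj_eq (@edge_inj D)) edgeK.
Qed.

(** The edges of the two sides of a cut, after the two edges of the cut have
    been replaced by an edge on each side. *)
Definition reglue p p' : D -> D :=
  tperm p (edge p') \o (tperm (edge p) p' \o @edge D).

Section Reglue.
Variables (S : {set D}) (p p' : D).
Hypothesis cS : cut S p p'.
Local Notation q := (edge p).
Local Notation q' := (edge p').
Local Notation e4 := (reglue p p').

Let SqN x y : x \in S -> y \notin S -> (x != y) * (y != x).
Proof.
by move=> xS yS; rewrite [y == x]eq_sym; split; apply: contraNneq yS => <-.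
Qed.

Let pq := SqN (cut_in cS) (cut_out cS).
Let pq' := SqN (cut_in cS) (cut_out' cS).
Let p'q := SqN (cut_in' cS) (cut_out cS).
Let p'q' := SqN (cut_in' cS) (cut_out' cS).
Let pp' : (p != p') * (p' != p).
Proof. by rewrite [p' == p]eq_sym (cut_neq cS). Qed.
Let qq' : (q != q') * (q' != q).
Proof. by rewrite [q' == q]eq_sym (inj_eq (@edge_inj D)) (cut_neq cS). Qed.

Lemma reglue_p : e4 p = p'.
Proof. by rewrite /reglue /= tpermL tpermD // ?pp' ?p'q'. Qed.

Lemma reglue_p' : e4 p' = p.
Proof. by rewrite /reglue /= [tperm q p' q']tpermD ?qq' ?p'q' // tpermR. Qed.

Lemma reglue_q : e4 q = q'.
Proof. by rewrite /reglue /= edgeK [tperm q p' p]tpermD ?tpermL // ?pq ?pp'. Qed.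

Lemma reglue_q' : e4 q' = q.
Proof. by rewrite /reglue /= edgeK tpermR tpermD // ?pq ?qq'. Qed.

Lemma reglueD x : x != p -> x != p' -> x != q -> x != q' -> e4 x = edge x.
Proof.
move=> xp xp' xq xq'; rewrite /reglue /= !tpermD // eq_sym.
all: by rewrite -(inj_eq (@edge_inj D)) ?edgeK // edgeK.
Qed.

Lemma reglueK : involutive e4.
Proof.
move=> x.
have [->|xp] := eqVneq x p; first by rewrite reglue_p reglue_p'.
have [->|xp'] := eqVneq x p'; first by rewrite reglue_p' reglue_p.
have [->|xq] := eqVneq x q; first by rewrite reglue_q reglue_q'.
have [->|xq'] := eqVneq x q'; first by rewrite reglue_q' reglue_q.
rewrite (reglueD xp) // reglueD ?edgeK //;
  by rewrite -(inj_eq (@edge_inj D)) edgeK // edgeK.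
Qed.

Lemma reglue_neq x : e4 x != x.
Proof.
have [->|xp] := eqVneq x p; first by rewrite reglue_p pp'.
have [->|xp'] := eqVneq x p'; first by rewrite reglue_p' pp'.
have [->|xq] := eqVneq x q; first by rewrite reglue_q qq'.
have [->|xq'] := eqVneq x q'; first by rewrite reglue_q' qq'.
by rewrite reglueD // edge_neq.
Qed.

Lemma reglue_in x : x \in S -> e4 x \in S.
Proof.
move=> xS.
have [->|xp] := eqVneq x p; first by rewrite reglue_p (cut_in' cS).
have [->|xp'] := eqVneq x p'; first by rewrite reglue_p' (cut_in cS).
rewrite reglueD // ?(cut_edge cS) //; apply: contraTneq xS => ->.
  exact: cut_out cS.
exact: cut_out' cS.
Qed.

Lemma reglue_inE x : (e4 x \in S) = (x \in S).
Proof.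
by apply/idP/idP; [move=> /reglue_in; rewrite reglueK|apply: reglue_in].
Qed.

Hypothesis conn : connected D.


(** The face that leaves [S] through [p] has to come back to [S], and cannot do
    so through [p] since no edge has the same face on both sides.  This is where
    planarity makes a two-edge cut a closed curve crossing two faces. *)
Lemma cut_face : fconnect (@face D) q p'.
Proof.
have [y xy /andP[yS fyS]] : exists2 y, fconnect (@face D) q y
    & (y \notin S) && (face y \in S).
  have := @fconnect_return _ (@face D) S (node (node (node p))).
  rewrite /face node4; apply=> //; first exact: face_inj.
    by rewrite !(cut_nodeE _ cS) (cut_in cS).
  exact: (cut_out cS).
have {}xy := connect_trans xy (fconnect1 _ _).
have nyS : node y \notin S by rewrite (cut_nodeE _ cS).
move: (cut_edge (cutC cS) (x := node y)); rewrite !inE -/(face y) fyS nyS.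
have [yq|_] := eqVneq (node y) q.
  by have := face_edge q conn; rewrite edgeK; move: xy; rewrite /face yq edgeK => ->.
have [yq' _|_] := eqVneq (node y) q'; first by move: xy; rewrite /face yq' edgeK.
by move=> /(_ isT isT isT).
Qed.

(** Each of the two transpositions that reglue the edges of the cut splits one
    of the two faces that the cut goes through. *)
Lemma fcard_reglue : fcard (e4 \o @node D) D = (fcard (@face D) D).+2.
Proof.
pose f1 := tperm q p' \o @face D.
have f1_inj : injective f1 by move=> x y /perm_inj /face_inj.
have := fcard_tperm q p' (@face_inj D); rewrite cut_face p'q.
have := fcard_tperm p q' f1_inj; rewrite pq'.
suff -> : fconnect f1 p q'.
  have -> : fcard (tperm p q' \o f1) D = fcard (e4 \o @node D) D by [].
  by rewrite /= !addn0 !addn1 => -> ->.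
have f1p' : f1 (node (node (node p'))) = q'.
  by rewrite /f1 /= /face node4 tpermD // ?qq' ?p'q'.
have [y xy /andP[yS fyS]] : exists2 y, fconnect f1 q' y
    & (y \notin S) && (f1 y \in S).
  have := @fconnect_return _ f1 S (node (node (node p'))).
  rewrite f1p'; apply=> //.
    by rewrite !(cut_nodeE _ cS) (cut_in' cS).
  exact: (cut_out' cS).
rewrite fconnect_sym //; apply: connect_trans xy _.
suff <- : f1 y = p by apply: fconnect1.
have nyS : node y \notin S by rewrite (cut_nodeE _ cS).
move: fyS; rewrite /f1 /= /face.
have [->|yq] := eqVneq (node y) q.
  by rewrite edgeK tpermD // ?pq ?pp'.
have [->|yq'] := eqVneq (node y) q'.
  by rewrite edgeK tpermR (negbTE (cut_out cS)).
have := cut_edge (cutC cS) (x := node y).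
rewrite !inE nyS => /(_ isT yq yq') eyS; rewrite tpermD ?(negbTE eyS) //.
  by rewrite (inj_eq (@edge_inj D)); apply: contraNneq nyS => <-; exact: cut_in cS.
by apply: contraNneq eyS => <-; exact: cut_in' cS.
Qed.

(** What can be reached from [p] inside [S], together with the complement of
    [S], is closed under the edges and vertices of the whole diagram. *)
Lemma reglue_connected : n_comp (step2 (@node D) e4) S = 1.
Proof.
have e4_inj := inv_inj reglueK.
have sym4 := step2_sym (@node_inj D) e4_inj.
rewrite -(n_comp_connect sym4 p); apply: eq_n_comp_r => x.
pose C := [set x | connect (step2 (@node D) e4) p x].
have pC : p \in C by rewrite inE connect0.
have nC y : y \in C -> node y \in C.
  by rewrite !inE => py; apply: connect_trans py (step2_connectl _ _ _).
have eC y : y \in C -> e4 y \in C.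
  by rewrite !inE => py; apply: connect_trans py (step2_connectr _ _ _).
have clS : closed (step2 (@node D) e4) S.
  apply: intro_closed => // u v /orP[] /eqP-> uS; first exact: cut_node cS _ uS.
  exact: reglue_in.
apply/idP/idP => [xS|px]; last first.
  by rewrite -(closed_connect clS px) (cut_in cS).
suff: (x \in C) || (x \notin S) by rewrite xS orbF inE.
apply: (connected_ind (P := fun x => (x \in C) || (x \notin S)) conn (x := p)).
- by rewrite pC.
- move=> y; have [->|yp] := eqVneq y p; first by rewrite (cut_out cS) orbT.
  have [->|yp'] := eqVneq y p'; first by rewrite (cut_out' cS) orbT.
  have [->|yq] := eqVneq y q; first by rewrite edgeK pC.
  have [->|yq'] := eqVneq y q'; first by rewrite edgeK -reglue_p eC.
  rewrite -reglueD // => /orP[/eC ->//|yS].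
  by rewrite reglue_inE yS orbT.
- by move=> y /orP[/nC ->//|yS]; rewrite (cut_nodeE _ cS) yS orbT.
Qed.

End Reglue.

Lemma eq_reglue S p p' : cut S p p' -> reglue (edge p) (edge p') =1 reglue p p'.
Proof.
move=> cS x; have cSC := cutC cS.
have [->|xp] := eqVneq x p.
  by have := reglue_q cSC; rewrite !edgeK (reglue_p cS).
have [->|xp'] := eqVneq x p'.
  by have := reglue_q' cSC; rewrite !edgeK (reglue_p' cS).
have [->|xq] := eqVneq x (edge p); first by rewrite (reglue_q cS) (reglue_p cSC).
have [->|xq'] := eqVneq x (edge p').
  by rewrite (reglue_q' cS) (reglue_p' cSC).
by rewrite !reglueD ?edgeK.
Qed.

End Cut.

(** * The two sides of a cut *)

Section Side.
Variable D : diagram.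
Implicit Types (S : {set D}) (p : D).

(** Regluing adds two faces and one component, so the genera of the two sides
    add up to zero; being nonnegative, they both vanish. *)
Lemma side_euler S p p' : cut S p p' -> connected D ->
  fcard (@node D) S + fcard (reglue p p') S + fcard (reglue p p' \o @node D) S
  = #|S| + 2.
Proof.
move=> cS conn; have cSC := cutC cS.
have e4_inj := inv_inj (reglueK cS).
have ge := genus_ge0_in (@node_inj D) e4_inj (cut_node cS) (reglue_in cS).
rewrite (reglue_connected cS conn) in ge.
have e4C x : x \in ~: S -> reglue p p' x \in ~: S.
  by rewrite !inE (reglue_inE cS).
have geC := genus_ge0_in (@node_inj D) e4_inj (cut_node cSC) e4C.
have KC : n_comp (step2 (@node D) (reglue p p')) (~: S) = 1.
  rewrite -(reglue_connected cSC conn); apply: eq_n_comp.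
  by apply: eq_connect => x y; rewrite /step2 /= (eq_reglue cS).
rewrite KC in geC.
have split_count (f : D -> D) : fcard f D = fcard f S + fcard f (~: S).
  rewrite (n_compC S); congr (_ + _).
  by apply: eq_n_comp_r => x; rewrite !inE.
have eul := euler_connected conn; have := fcard_reglue cS conn.
have : fcard (reglue p p') D = fcard (@edge D) D.
  apply/eqP; rewrite -(eqn_pmul2r (ltn0Sn 1)) fcard_edge2.
  rewrite (@eq_n_comp_r _ _ D [set: D]); last by move=> x; rewrite !inE.
  rewrite even_fpf ?cardsT // => [|x _]; first exact: (reglueK cS).
  exact: (reglue_neq cS).
have cardD : #|D| = #|S| + #|~: S| by rewrite cardsC.
move: eul; rewrite cardD !split_count => eul E F.
have arith (v v' e e' f f' s s' E0 F0 : nat) :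
    v + e + f <= s + 1.*2 -> v' + e' + f' <= s' + 1.*2 ->
    v + v' + E0 + F0 = s + s' + 2 -> e + e' = E0 -> f + f' = F0.+2 ->
    v + e + f = s + 2 by lia.
exact: arith ge geC eul E F.
Qed.

(** [f] embeds [A] as the side [S] of a cut of the diagram; the two half-edges
    of the cut are joined in [A] into one edge, that of [a]. *)
Record side_of S p p' (A : diagram) (f : A -> D) (a : A) : Prop := SideOf {
  side_inj : injective f;
  side_codom : forall d, (d \in codom f) = (d \in S);
  side_node : forall x : A, node (f x) = f (node x);
  side_over : forall x : A, over (f x) = over x;
  side_edge : forall x : A, x \notin [:: a; edge a] -> edge (f x) = f (edge x);
  side_a : f a = p;
  side_a' : f (edge a) = p' }.

Lemma side_exists S p p' : cut S p p' -> connected D ->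
  exists (A : diagram) (f : A -> D) (a : A), side_of S p p' f a /\ connected A.
Proof.
move=> cS conn; pose TS : finType := {x : D | x \in S}.
have e4_inj := inv_inj (reglueK cS).
have nS := cut_node cS; have eS := reglue_in cS.
have neS x : x \in S -> (reglue p p' \o @node D) x \in S.
  by move=> xS; apply/eS/nS.
pose n : TS -> TS := sub_fun nS; pose e : TS -> TS := sub_fun eS.
have TS_gt0 : 0 < #|TS|.
  by apply/card_gt0P; exists (exist _ p (cut_in cS)).
have eK : involutive e by move=> x; apply: val_inj; apply: (reglueK cS).
have eN x : e x != x by rewrite -val_eqE /= (reglue_neq cS).
have n4 x : iter 4 n x = x by apply: val_inj; apply: node_order4.
have nN x : n x != x by rewrite -val_eqE /= node_neq.
have ov x : n (n x) != x -> over (val (n x)) = ~~ over (val x).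
  by rewrite -val_eqE; apply: over_node.
have ovc x : over (val x) -> n (n x) != x.
  by rewrite -val_eqE; apply: over_crossing.
have K1 : n_comp [rel d d' : TS | (d' == e d) || (d' == n d)] TS = 1.
  have <- := etrans (n_comp_step2_sub nS eS (@node_inj D) e4_inj)
                    (reglue_connected cS conn).
  by apply: eq_n_comp; apply: eq_connect => x y; rewrite /= orbC.
have euler : fcard n TS + fcard (fun d => e (n d)) TS
    = fcard e TS + 2 * n_comp [rel d d' : TS | (d' == e d) || (d' == n d)] TS.
  rewrite K1 muln1 (fcard_sub nS) ?(fcard_sub eS) //; last exact: node_inj.
  have -> : fcard (fun d => e (n d)) TS = fcard (reglue p p' \o @node D) S.
    rewrite -(fcard_sub neS); last by apply: inj_comp => //; apply: node_inj.
    by apply: eq_fcard => x; apply: val_inj.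
  have := side_euler cS conn.
  rewrite -(even_fpf (reglueK cS) eS (fun x _ => reglue_neq cS x)) muln2 -addnn.
  by rewrite addnAC -!addnA [X in _ + X = _]addnC addnCA => /addnI; rewrite addnC.
pose A := @Diagram TS e n (fun x => over (val x)) TS_gt0 eK eN n4 nN ov ovc euler.
exists A, (fun x : A => val (x : TS)), (exist _ p (cut_in cS) : TS).
split; last by rewrite /connected; apply/eqP.
split=> //.
- exact: val_inj.
- move=> d; apply/codomP/idP => [[x ->]|dS]; first exact: valP x.
  by exists (exist _ d dS : TS).
- move=> [x xS]; rewrite !inE negb_or -!val_eqE /= (reglue_p cS) => /andP[xp xp'].
  rewrite reglueD //; apply: contraTneq xS => ->.
    exact: cut_out cS.
  exact: cut_out' cS.
- exact: (reglue_p cS).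
Qed.

Lemma between_sym : connect_sym (@between_crossings D).
Proof.
apply: sym_connect_sym => x y; apply/idP/idP.
  case/orP=> [/eqP->|/andP[mx /eqP->]]; rewrite /between_crossings /= ?edgeK ?eqxx //.
  by rewrite crossing_node mx marked_node2 ?eqxx ?orbT.
case/orP=> [/eqP->|/andP[mx /eqP->]]; rewrite /between_crossings /= ?edgeK ?eqxx //.
by rewrite crossing_node mx marked_node2 ?eqxx ?orbT.
Qed.

Section SideTheory.
Variables (S : {set D}) (p p' : D) (A : diagram) (f : A -> D) (a : A).
Hypotheses (cS : cut S p p') (sA : side_of S p p' f a) (conn : connected D).

Lemma side_crossing (x : A) : crossing (f x) = crossing x.
Proof. by rewrite /crossing !(side_node sA) (inj_eq (side_inj sA)). Qed.

Lemma side_in (x : A) : f x \in S.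
Proof. by rewrite -(side_codom sA) codom_f. Qed.

(** The two faces next to the new edge of a side are parts of faces of the
    whole diagram, the other part lying on the other side of the cut. *)
Lemma side_face (x y : A) : fconnect (@face A) x y -> fconnect (@face D) (f x) (f y).
Proof.
move=> /iter_findex <-; elim: (findex _ x y) => [|n IHn]; first exact: connect0.
apply: connect_trans IHn _; rewrite iterS; move: (iter n _ x) => {y n}z.
rewrite {2}/face; have [xa|xNa] := eqVneq (node z) a.
  rewrite xa (side_a' sA) same_fconnect1 ?[face _]/(edge _); last exact: face_inj.
  by rewrite /face (side_node sA) xa (side_a sA); apply: (cut_face cS conn).
have [xa'|xNa'] := eqVneq (node z) (edge a).
  rewrite xa' edgeK (side_a sA) same_fconnect1; last exact: face_inj.
  rewrite {2}/face (side_node sA) xa' (side_a' sA).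
  exact: (cut_face (cut_sym cS) conn).
rewrite -(side_edge sA); last by rewrite !inE negb_or xNa.
by rewrite -(side_node sA); apply: fconnect1.
Qed.

Lemma side_reduced : reduced D -> reduced A.
Proof.
move=> red x cx; apply/negP=> /side_face xx.
have := red (f x); rewrite side_crossing !(side_node sA) => /(_ cx).
by rewrite xx.
Qed.

(** The new edge joins the ends of two segments of the diagram; alternation
    survives if one of these ends is above and the other one below. *)
Lemma side_alternating (c : bool) : alternating D ->
    (forall z, z \in S -> crossing z -> connect (@between_crossings D) p z ->
       over z = c) ->
    (forall z, z \in S -> crossing z -> connect (@between_crossings D) p' z ->
       over z = ~~ c) ->
  alternating A.
Proof.
move=> alt pc p'c; pose seg := connect (@between_crossings D).
pose near z := seg p z || seg p' z.
have near_seg u v : seg u v -> near u -> near v.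
  by move=> uv /orP[] h; apply/orP; [left|right]; apply: connect_trans uv.
have segC u v : seg u v = seg v u by apply: between_sym.
have R x y : connect (@between_crossings A) x y ->
    seg (f x) (f y) || near (f x) && near (f y).
  move=> /connectP[s s_path ->]; elim: s x s_path => [|z s IHs] x /=.
    by rewrite /seg connect0.
  case/andP=> xz /IHs {IHs}; set w := f (last z s).
  have : seg (f x) (f z) || near (f x) && near (f z).
    case/orP: xz => [/eqP->|/andP[mx /eqP->]]; last first.
      by apply/orP; left; apply: connect1;
         rewrite /between_crossings /= side_crossing mx (side_node sA) eqxx orbT.
    have [xa|xNa] := eqVneq x a.
      rewrite xa (side_a sA) (side_a' sA) /near {2}/seg connect0.
      by rewrite [seg p' p']connect0 !orbT.
    have [xa'|xNa'] := eqVneq x (edge a).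
      rewrite xa' edgeK (side_a sA) (side_a' sA) /near {4}/seg connect0.
      by rewrite [seg p' p']connect0 !orbT.
    apply/orP; left; apply: connect1; rewrite /between_crossings /=.
    by rewrite (side_edge sA) ?eqxx // !inE negb_or xNa.
  case/orP=> [xz'|/andP[nx nz]] /orP[zw|/andP[nz' nw]].
  - by rewrite [seg _ _](connect_trans xz').
  - by rewrite nw andbT (near_seg (f z)) ?orbT // segC.
  - by rewrite nx (near_seg (f z)) ?orbT.
  - by rewrite nx nw orbT.
move=> d d' cd cd' dd' /R.
have fdd' : f d != f d' by rewrite (inj_eq (side_inj sA)).
rewrite -!(side_over sA).
have [cfd cfd'] : crossing (f d) /\ crossing (f d') by rewrite !side_crossing.
case/orP=> [|/andP[/orP[nd|nd] /orP[nd'|nd']]]; first exact: alt.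
- by apply: alt => //; apply: connect_trans nd'; rewrite -/seg segC.
- by rewrite (pc (f d)) ?(p'c (f d')) ?side_in.
- by rewrite (p'c (f d)) ?(pc (f d')) ?side_in ?negbK.
- by apply: alt => //; apply: connect_trans nd'; rewrite -/seg segC.
Qed.

End SideTheory.

Lemma joins_sides S p p' (A B : diagram) (f : A -> D) (g : B -> D) a b :
    side_of S p p' f a -> side_of (~: S) (edge p) (edge p') g b ->
  joins f g a b.
Proof.
move=> sA sB; split.
- by split; [apply: side_inj sA|apply: side_inj sB].
- by move=> d; rewrite (side_codom sA) (side_codom sB) inE negbK.
- by split=> x; rewrite ?(side_node sA) ?(side_over sA) ?(side_node sB) ?(side_over sB).
- by split; [apply: side_edge sA|apply: side_edge sB].
- by rewrite (side_a sA) (side_a sB) (side_a' sA) (side_a' sB).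
Qed.

End Side.

(** * Segments between crossings *)

Lemma connect_ind (T : finType) (e : rel T) (P : T -> Prop) x y :
  P x -> (forall u v, P u -> e u v -> P v) -> connect e x y -> P y.
Proof.
move=> Px Pe /connectP[s s_path ->]; elim: s x Px s_path => //= z s IHs x Px.
by case/andP=> /(Pe _ _ Px) /IHs; apply.
Qed.

Section Segments.
Variable D : diagram.
Implicit Types d x y z w : D.

(** The edges of the diagram once its marked points are forgotten. *)
Definition segment : rel D := connect (@between_crossings D).

Lemma segment_refl d : segment d d. Proof. exact: connect0. Qed.

Lemma segment_sym x y : segment x y = segment y x.
Proof. exact: between_sym. Qed.

Lemma segment_trans x y z : segment x y -> segment y z -> segment x z.
Proof. exact: connect_trans. Qed.

Lemma segment_edge d : segment d (edge d).
Proof. by apply: connect1; rewrite /between_crossings /= eqxx. Qed.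

Lemma segment_node d : ~~ crossing d -> segment d (node d).
Proof.
by move=> md; apply: connect1; rewrite /between_crossings /= md eqxx orbT.
Qed.

(** A face next to a segment follows it from one crossing to the
    next, and this walk exhausts the segment. *)
Lemma segment_walk d : crossing d ->
  exists w, [/\ crossing w, segment d w, fconnect (@face D) (edge d) w &
    forall z, crossing z -> segment d z -> z = d \/ z = w].
Proof.
move=> cd; pose u i := iter i (@face D) (edge d).
have ex_c : exists i, crossing (u i).
  have: fconnect (@face D) (edge d) (finv (@face D) (edge d)).
    exact: fconnect_finv.
  move=> /iter_findex eqz; exists (findex (@face D) (edge d) (finv (@face D) (edge d))).
  rewrite /u eqz; have /edge_inj nd := f_finv (@face_inj D) (edge d).
  by rewrite -crossing_node nd.
have [i ci min_i] := ex_minnP ex_c.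
have marked_u j : j < i -> ~~ crossing (u j).
  by move=> ji; apply: contraL ji => /min_i; rewrite -leqNgt.
have uS j : u j.+1 = edge (node (u j)) by [].
have seg_u j : j <= i -> segment d (u j).
  elim: j => [_|j IHj ji]; first exact: segment_edge.
  apply: segment_trans (IHj (ltnW ji)) _; rewrite uS.
  exact: segment_trans (segment_node (marked_u _ ji)) (segment_edge _).
exists (u i); split=> //; first exact: seg_u.
  exact: fconnect_iter.
pose P z := [\/ z = d, exists2 j, j <= i & z = u j | exists2 j, j < i & z = node (u j)].
move=> z cz dz; have : P z; last first.
  case=> [->|[j ji zj]|[j ji zj]]; [by left|right|]; last first.
    by have := marked_u j ji; rewrite -crossing_node -zj cz.
  rewrite zj; congr u; apply/eqP; rewrite eqn_leq ji min_i //.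
  by rewrite -zj.
apply: connect_ind dz; first by constructor 1.
move=> {cz}x y [->|[j ji ->]|[j ji ->]] /orP[/eqP->|/andP[mx /eqP->]].
- by constructor 2; exists 0.
- by rewrite cd in mx.
- case: j ji => [_|j ji]; first by constructor 1; rewrite /u /= edgeK.
  by constructor 3; exists j; rewrite // uS edgeK.
- constructor 3; exists j => //; rewrite ltn_neqAle ji andbT.
  by apply: contraNneq mx => ->.
- by constructor 2; exists j.+1.
- constructor 2; exists j; first exact: ltnW.
  by rewrite marked_node2 ?marked_u.
Qed.

(** A segment has an even number of ends: edges pair all its darts, and nodes
    pair those at marked points. *)
Lemma segment_end d : crossing d ->
  exists z, [/\ crossing z, segment d z & z != d].
Proof.
move=> cd; pose C := [set z | segment d z].
have [/existsP[z /and3P[cz dz zd]]|no_z] :=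
    boolP [exists z, [&& crossing z, segment d z & z != d]].
  by exists z.
have dC : d \in C by rewrite inE segment_refl.
have evenC : ~~ odd #|C|.
  apply: (@even_card_fpf _ (@edge D)) => [|x|x _]; first exact: edgeK.
    by rewrite !inE => dx; apply: segment_trans dx (segment_edge _).
  exact: edge_neq.
have markC x : x \in C -> x != d -> ~~ crossing x.
  rewrite inE => dx xd; apply: contra no_z => cx; apply/existsP; exists x.
  by rewrite cx dx.
have: ~~ odd #|C :\ d|.
  apply: (@even_card_fpf _ (@through D)) => [|x|x _]; first exact: throughK.
    rewrite !in_setD1 => /andP[xd xC]; have mx := markC _ xC xd.
    rewrite /through (negbTE mx); apply/andP; split.
      by apply: contraNneq mx => nxd; rewrite -crossing_node nxd.
    by move: xC; rewrite !inE => dx; apply: segment_trans dx (segment_node _).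
  exact: through_neq.
by move: evenC; rewrite (cardsD1 d C) dC add1n /= negbK => ->.
Qed.

(* The other end of the segment ending at the crossing dart [d]; at a crossing
   dart the default value does not occur. *)
Definition other d :=
  odflt d [pick w | [&& crossing w, segment d w & w != d]].

Lemma other_spec d : crossing d ->
  [&& crossing (other d), segment d (other d) & other d != d].
Proof.
move=> cd; rewrite /other; case: pickP => //= no_w.
by have [z [cz dz zd]] := segment_end cd; have := no_w z; rewrite cz dz zd.
Qed.

Lemma crossing_other d : crossing d -> crossing (other d).
Proof. by move=> /other_spec/and3P[]. Qed.

Lemma segment_other d : crossing d -> segment d (other d).
Proof. by move=> /other_spec/and3P[]. Qed.

Lemma other_neq d : crossing d -> other d != d.
Proof. by move=> /other_spec/and3P[]. Qed.

Lemma other_uniq d z : crossing d -> crossing z -> segment d z ->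
  z = d \/ z = other d.
Proof.
move=> cd cz dz; have [w [_ _ _ wP]] := segment_walk cd.
case: (wP _ (crossing_other cd) (segment_other cd)) => [e|->].
  by have := other_neq cd; rewrite e eqxx.
exact: wP.
Qed.

Lemma other_face d : crossing d -> fconnect (@face D) (edge d) (other d).
Proof.
move=> cd; have [w [_ _ dw wP]] := segment_walk cd.
case: (wP _ (crossing_other cd) (segment_other cd)) => [e|->] //.
by have := other_neq cd; rewrite e eqxx.
Qed.

Lemma otherK d : crossing d -> other (other d) = d.
Proof.
move=> cd; have co := crossing_other cd.
have: segment (other d) d by rewrite segment_sym segment_other.
case/(other_uniq co cd) => // e.
by have := other_neq cd; rewrite -e eqxx.
Qed.

Lemma over_is_crossing d : over d -> crossing d.
Proof. exact: over_crossing. Qed.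

Section Alternating.
Hypothesis alt : alternating D.

Lemma over_other d : crossing d -> over (other d) = ~~ over d.
Proof.
move=> cd; apply: alt (segment_other cd) => //; first exact: crossing_other.
by rewrite eq_sym other_neq.
Qed.

End Alternating.

Lemma along_sym : connect_sym (@along_arc D).
Proof.
have imp x y : along_arc x y -> along_arc y x.
  case/or3P=> [/eqP->|/andP[mx /eqP->]|/andP[ox /eqP->]];
    rewrite /along_arc /= ?edgeK ?eqxx //.
    by rewrite crossing_node mx marked_node2 ?eqxx ?orbT.
  by rewrite (over_node2 (over_is_crossing ox)) ox node4 eqxx !orbT.
by apply: sym_connect_sym => x y; apply/idP/idP; apply: imp.
Qed.

Lemma arc_atE x y : (arc_at x == arc_at y) = connect (@along_arc D) x y.
Proof.
rewrite -val_eqE /=; apply/eqP/idP => [/setP/(_ y)|xy].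
  by rewrite !inE connect0.
by apply/setP=> z; rewrite !inE (same_connect along_sym xy).
Qed.

Lemma segment_along x y : segment x y -> connect (@along_arc D) x y.
Proof.
apply: connect_sub => {x y} x y xy; apply: connect1.
by case/orP: xy => h; rewrite /along_arc /= h ?orbT.
Qed.

Lemma arc_at_segment x y : segment x y -> arc_at x = arc_at y.
Proof. by move=> /segment_along; rewrite -arc_atE => /eqP. Qed.

Lemma arc_at_over d : over d -> arc_at (node (node d)) = arc_at d.
Proof.
move=> od; apply/eqP; rewrite eq_sym arc_atE; apply: connect1.
by rewrite /along_arc /= od eqxx !orbT.
Qed.

Lemma arc_over d z : alternating D -> over d ->
  (arc_at z == arc_at d) = segment d z || segment (node (node d)) z.
Proof.
move=> alt od; have cd := over_is_crossing od.
have cd2 : crossing (node (node d)) by rewrite !crossing_node.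
have od2 : over (node (node d)) by rewrite over_node2.
apply/idP/idP; last first.
  by case/orP=> /arc_at_segment <-; rewrite ?arc_at_over.
rewrite eq_sym arc_atE; 
apply: (connect_ind (P := fun z => segment d z || segment (node (node d)) z)).
  by rewrite segment_refl.
have only u v : over u -> over v -> segment u v -> v = u.
  move=> ou ov uv; have [cu cv] := (over_is_crossing ou, over_is_crossing ov).
  by case: (other_uniq cu cv uv) ov => // ->; rewrite over_other // ou.
move=> x y dx /or3P[/eqP->|/andP[mx /eqP->]|/andP[ox /eqP->]].
- by case/orP: dx => h; rewrite (segment_trans h (segment_edge _)) ?orbT.
- by case/orP: dx => h; rewrite (segment_trans h (segment_node mx)) ?orbT.
- case/orP: dx => /only ->//; rewrite ?segment_refl ?orbT //.
  by rewrite node4 segment_refl.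
Qed.

Lemma segment_crossing d0 z : connected D -> crossing d0 ->
  exists2 d, crossing d & segment z d.
Proof.
move=> conn cd0.
suff /existsP[d /andP[]] : [exists d, crossing d && segment z d] by exists d.
apply: (connected_ind
  (P := fun z => [exists d, crossing d && segment z d]) conn (x := d0)).
- by apply/existsP; exists d0; rewrite cd0 segment_refl.
- move=> y /existsP[d /andP[cd yd]]; apply/existsP; exists d.
  by rewrite cd; apply: segment_trans yd; rewrite segment_sym segment_edge.
- move=> y /existsP[d /andP[cd yd]]; apply/existsP.
  have [cy|my] := boolP (crossing y).
    by exists (node y); rewrite crossing_node cy segment_refl.
  exists d; rewrite cd; apply: segment_trans yd.
  by rewrite segment_sym segment_node.
Qed.

End Segments.

(** * Relations between the arcs of an alternating diagram *)

Import Order.TTheory GRing.Theory Num.Theory.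

Section Balance.
Local Open Scope ring_scope.

Lemma class_byE (V : zmodType) (I : finType) (r : I -> V) (u v : V) :
  class_by r u = class_by r v <->
  exists c : I -> int, u - v = \sum_i r i *~ c i.
Proof.
have E : (u - v \in int_span r) = (class_by r u == class_by r v).
  exact: Quotient.idealrBE.
split=> [/eqP|uv]; first by rewrite -E => /asboolP.
by apply/eqP; rewrite -E; apply/asboolP.
Qed.

Variable D : diagram.
Implicit Types d x y z w : D.

Lemma crossing_relationE (i : {d : D | over d}) (A : Arc D) :
  crossing_relation i A = (A == arc_at (val i))%:R *+ 2
    - (A == arc_at (node (val i)))%:R
    - (A == arc_at (node (node (node (val i)))))%:R.
Proof.
have ffun3 (u v w : {ffun Arc D -> int}) :
    (u *+ 2 - v - w) A = u A *+ 2 - v A - w A.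
  by rewrite !ffunE -mulr2n.
by rewrite [LHS]ffun3; congr (_ *+ 2 - _ - _); apply: ffunE.
Qed.

(** The two over-darts of a crossing have the same relation, so that only the
    sum of their coefficients matters. *)
Definition crossing_weight (X : D -> int) d : int :=
  if over d then X d + X (node (node d))
  else X (node d) + X (node (node (node d))).

Lemma crossing_weight_node (X : D -> int) d : crossing d ->
  crossing_weight X (node d) = crossing_weight X d.
Proof.
move=> cd; rewrite /crossing_weight over_node1 // node4.
by case: (over d) => //=; rewrite addrC.
Qed.

Lemma sum_over2 (P X : D -> int) u v : over u -> over v -> u != v ->
    (forall o, over o -> P o = ((o == u) || (o == v))%:R) ->
  \sum_(o | over o) P o * X o = X u + X v.
Proof.
move=> ou ov uv PE; rewrite (bigD1 u) //= (bigD1 v) /=; last first.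
  by rewrite ov eq_sym.
rewrite !PE // !eqxx orbT !mul1r big1 ?addr0 // => o /andP[/andP[oo ou'] ov'].
by rewrite PE // (negbTE ou') (negbTE ov') mul0r.
Qed.

(** An arc of an alternating diagram passes above one crossing and ends below
    two.  Reading the coefficient of this arc in a combination of the relations
    compares the weight of its crossing with the mean of the weights of the
    crossings at its ends. *)
Lemma alternating_balance (a b : Arc D) : alternating D ->
    Col_gen a = Col_gen b ->
  exists y : D -> int,
    (forall z, crossing z -> y (node z) = y z) /\
    (forall z, over z -> y z *+ 2 - y (other z) - y (other (node (node z)))
       = (arc_at z == a)%:R - (arc_at z == b)%:R).
Proof.
move=> alt /class_byE[c eq_c].
(* the coefficients of the relations, as a function vanishing off over-darts *)
pose X d := if insub d is Some i then c i else 0.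
have Xval (i : {d : D | over d}) : X (val i) = c i by rewrite /X valK.
have eqX A : (A == a)%:R - (A == b)%:R = \sum_(o | over o)
    ((arc_at o == A)%:R *+ 2 - (arc_at (node o) == A)%:R
      - (arc_at (node (node (node o))) == A)%:R) * X o.
  have -> : (A == a)%:R - (A == b)%:R = (arc_gen a - arc_gen b) A :> int.
    by rewrite !ffunE.
  rewrite eq_c sum_ffunE; under eq_bigr => i _ do rewrite -Xval.
  transitivity (\sum_(i : {d : D | over d})
    (fun o => ((arc_at o == A)%:R *+ 2 - (arc_at (node o) == A)%:R
      - (arc_at (node (node (node o))) == A)%:R) * X o) (val i)).
    apply: eq_bigr => i _; rewrite ffunMzE mulrzz crossing_relationE.
    by rewrite ![A == _]eq_sym.
  exact/esym/(@big_sub _ _ _ D (@over D)).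
exists (crossing_weight X); split=> [z|z oz]; first exact: crossing_weight_node.
have cz := over_is_crossing oz; set z2 := node (node z).
have cz2 : crossing z2 by rewrite !crossing_node.
have oz2 : over z2 by rewrite over_node2.
have z2z : z2 != z by [].
have oz_other w : crossing w -> over w -> over (other w) = false.
  by move=> cw ow; rewrite over_other // ow.
have [cw cw2] := (crossing_other cz, crossing_other cz2).
have [ow ow2] := (oz_other _ cz oz, oz_other _ cz2 oz2).
have ww2 : other z != other z2.
  by apply: contraNneq z2z => e; rewrite -(otherK cz2) -e otherK.
have mem_over o : over o -> (arc_at o == arc_at z) = (o == z) || (o == z2).
  move=> oo; rewrite arc_over //; have co := over_is_crossing oo.
  apply/idP/idP; last by case/orP=> /eqP->; rewrite segment_refl ?orbT.
  case/orP=> /other_uniq [] // e; rewrite ?e ?eqxx ?orbT //.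
    by rewrite e ow in oo.
  by rewrite e ow2 in oo.
have mem_under o : crossing o -> ~~ over o ->
    (arc_at o == arc_at z) = (o == other z) || (o == other z2).
  move=> co oo; rewrite arc_over //.
  apply/idP/idP; last by case/orP=> /eqP->; rewrite segment_other ?orbT.
  case/orP=> /other_uniq [] // e; rewrite ?e ?eqxx ?orbT //.
    by rewrite e oz in oo.
  by rewrite e oz2 in oo.
rewrite eqX; under eq_bigr => o _ do rewrite mulr2n !mulrBl mulrDl.
rewrite !sumrB big_split /= -mulr2n.
rewrite (sum_over2 _ (u := z) (v := z2)) //; last 2 first.
- by rewrite eq_sym.
- by move=> o oo; rewrite mem_over.
rewrite (sum_over2 _ (u := node (node (node (other z))))
                     (v := node (node (node (other z2))))); first last.
- move=> o oo; rewrite mem_under ?crossing_node ?over_node1 ?over_is_crossing ?oo //.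
  by rewrite -!(inj_eq (@node_inj D) o) !node4.
- by rewrite !(inj_eq (@node_inj D)).
- by rewrite over_node3 // ow2.
- by rewrite over_node3 // ow.
rewrite (sum_over2 _ (u := node (other z)) (v := node (other z2))); first last.
- move=> o oo; rewrite mem_under ?crossing_node ?over_node3 ?over_is_crossing ?oo //.
  by rewrite -[o in RHS]node4 !(inj_eq (@node_inj D)).
- by rewrite (inj_eq (@node_inj D)).
- by rewrite over_node1 // ow2.
- by rewrite over_node1 // ow.
rewrite /crossing_weight oz ow ow2 -/z2 -[LHS]addrA -[RHS]addrA -!opprD.
by congr (_ + - _); rewrite addrACA addrC.
Qed.

End Balance.

(** * The maximum principle *)

Import Order.TTheory GRing.Theory Num.Theory.

Lemma mean_of_max (m u v : int) (c : bool) : (u <= m -> v <= m ->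
  m *+ 2 - u - v = 0 - c%:R -> (c = false) /\ (u = m))%R.
Proof. by rewrite mulr2n; case: c => /=; lia. Qed.

Lemma mean_below_max (m u v : int) : (u <= m -> v <= m ->
  m *+ 2 - u - v = 1 - 0 -> u <> m -> v = m)%R.
Proof. rewrite mulr2n; lia. Qed.

Section Level.
Variable D : diagram.
Implicit Types d x y z w : D.
Hypotheses (conn : connected D) (alt : alternating D).
Implicit Type T : {set D}.

(** A set of crossings, given by their darts. *)
Definition crossing_set T :=
  [forall z in T, crossing z && (node z \in T)].

Lemma crossing_setP T : reflect
  (forall z, z \in T -> crossing z /\ node z \in T) (crossing_set T).
Proof.
apply: (iffP forall_inP) => TP z zT; first exact/andP/TP.
exact/andP/TP.
Qed.

Lemma crossing_set_node T z : crossing_set T -> (node z \in T) = (z \in T).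
Proof.
move=> /crossing_setP TP; apply/idP/idP => [|/TP[]//].
by do 3!move=> /TP[_]; rewrite node4.
Qed.

Lemma crossing_setI T T' :
  crossing_set T -> crossing_set T' -> crossing_set (T :&: T').
Proof.
move=> /crossing_setP TP /crossing_setP TP'; apply/crossing_setP=> z.
by rewrite !inE => /andP[/TP[cz ->] /TP'[_ ->]].
Qed.

Lemma crossing_setU T T' :
  crossing_set T -> crossing_set T' -> crossing_set (T :|: T').
Proof.
move=> /crossing_setP TP /crossing_setP TP'; apply/crossing_setP=> z.
by rewrite !inE => /orP[/TP[cz ->]|/TP'[cz ->]]; rewrite ?orbT.
Qed.

Lemma crossing_setC T :
  crossing_set T -> crossing_set [set z | crossing z & z \notin T].
Proof.
move=> TP; apply/crossing_setP=> z.
by rewrite !inE crossing_node (crossing_set_node _ TP) => /andP[-> ->].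
Qed.

(** Alternation directs each segment from its upper end to its lower end;
    [outs T] and [ins T] are the segments leaving and entering [T], each given by
    its upper end. *)
Definition outs T : {set D} := [set z in T | over z & other z \notin T].
Definition ins T : {set D} := [set z | [&& over z, z \notin T & other z \in T]].

(** At each crossing two segments start and two end: as many segments leave a
    set of crossings as enter it. *)
Lemma card_outs_ins T : crossing_set T -> #|outs T| = #|ins T|.
Proof.
move=> TP; have TP' := elimT (crossing_setP T) TP.
pose I := [set z in T | over z & other z \in T].
pose U := [set z in T | over z]; pose L := [set z in T | ~~ over z].
have UL : #|U| = #|L|.
  rewrite -(card_imset _ (@node_inj D)); apply: eq_card => z.
  rewrite inE; apply/imsetP/andP => [[w]|[zT oz]].
    rewrite inE => /andP[wT ow] ->; have [cw nw] := TP' _ wT.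
    by rewrite over_node1 // negbK.
  exists (node (node (node z))); last by rewrite node4.
  have [cz _] := TP' _ zT.
  by rewrite inE !(crossing_set_node _ TP) zT over_node3.
have UI : #|U| = #|I| + #|outs T|.
  rewrite -(cardsID [set z | other z \in T]); congr (_ + _).
    by apply: eq_card => z; rewrite !inE andbA.
  by apply: eq_card => z; rewrite !inE andbC andbA.
have LI : #|L| = #|I| + #|ins T|.
  have -> : L = (@other D) @: (I :|: ins T).
    apply/setP=> z; apply/idP/imsetP => [|[w]].
      rewrite inE => /andP[zT oz]; have [cz _] := TP' _ zT.
      exists (other z); last by rewrite otherK.
      rewrite !inE otherK // zT over_other // oz !andbT /=.
      by case: (_ \in T).
    rewrite !inE => w_in ->.
    have [ow owT] : over w /\ other w \in T.
      by case/orP: w_in => /and3P[] // _ -> ->.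
    by rewrite owT over_other ?over_is_crossing ?ow.
  rewrite card_in_imset; last first.
    move=> u v; rewrite !inE => uI vI uv.
    have [ou ov] : over u /\ over v.
      by split; [case/orP: uI|case/orP: vI] => /and3P[].
    by rewrite -(otherK (over_is_crossing ou)) uv otherK ?over_is_crossing.
  rewrite cardsU [I :&: _](_ : _ = set0) ?cards0 ?subn0 //.
  by apply/setP=> z; rewrite !inE; case: (z \in T); rewrite ?andbF.
by apply/eqP; rewrite -(eqn_add2l #|I|) -UI -LI UL.
Qed.

(** By the previous count no segment enters such a set either, so that one never
    leaves it when walking through the connected diagram. *)
Lemma outs_eq0 T x : crossing_set T -> x \in T -> outs T = set0 ->
  forall z, crossing z -> z \in T.
Proof.
move=> TP xT out0; have TP' := elimT (crossing_setP T) TP.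
have in0 : ins T = set0 by apply/eqP; rewrite -cards_eq0 -card_outs_ins // out0 cards0.
have clT z : z \in T -> other z \in T.
  move=> zT; have [cz _] := TP' _ zT; have [oz|uz] := boolP (over z).
    by have := in_set0 z; rewrite -out0 !inE zT oz => /negbFE.
  have := in_set0 (other z); rewrite -in0 !inE otherK // zT over_other // uz.
  by rewrite andbT => /negbFE.
suff PT z : [forall w, crossing w ==> segment z w ==> (w \in T)].
  by move=> z cz; have /forallP/(_ z) := PT z; rewrite cz segment_refl.
apply: (connected_ind (P := fun z =>
  [forall w, crossing w ==> segment z w ==> (w \in T)]) conn (x := x)).
- apply/forallP=> w; apply/implyP=> cw; apply/implyP=> xw.
  have [cx _] := TP' _ xT.
  by case: (other_uniq cx cw xw) => ->; rewrite ?clT.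
- move=> y /forallP PTy; apply/forallP=> w; apply/implyP=> cw; apply/implyP=> yw.
  have := PTy w; rewrite cw /= => /implyP; apply.
  exact: segment_trans (segment_edge _) yw.
- move=> y /forallP PTy; apply/forallP=> w; apply/implyP=> cw; apply/implyP=> yw.
  have [cy|my] := boolP (crossing y); last first.
    have := PTy w; rewrite cw /= => /implyP; apply.
    exact: segment_trans (segment_node my) yw.
  have yT : y \in T by have := PTy y; rewrite cy segment_refl.
  have [cny nyT] : crossing (node y) /\ node y \in T.
    by rewrite crossing_node cy (crossing_set_node _ TP).
  by case: (other_uniq cny cw yw) => ->; rewrite ?clT.
Qed.

(** The maximum principle: a weighting balanced at all crossings but two takes
    its maximum on a set of crossings that only one segment leaves, since a
    maximal value is the mean of its two successors except at one crossing. *)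
Lemma balance_level (a b : Arc D) x z :
    Col_gen a = Col_gen b -> a <> b -> over x -> over z ->
    arc_at x = a -> arc_at z = b ->
  exists T, [/\ crossing_set T, x \in T, z \notin T & #|outs T| = 1%N].
Proof.
move=> eq_ab ab ox oz xa zb.
have [y [y_node y_bal]] := alternating_balance alt eq_ab; clear eq_ab.
have abF : (b == a) = false by apply/eqP=> /esym.
have cx := over_is_crossing ox.
have [m cm max_m] : exists2 m, crossing m & forall w, crossing w -> (y w <= y m)%R.
  by case: (@arg_maxP _ _ _ x (@crossing D) y cx) => m; exists m.
have [T inT] : exists T, forall w, (w \in T) = crossing w && (y w == y m).
  by exists [set w | crossing w && (y w == y m)] => w; rewrite inE.
have TP : crossing_set T.
  apply/crossing_setP=> w; rewrite !inT => /andP[cw /eqP yw].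
  by rewrite crossing_node y_node // cw yw eqxx.
have bal w : over w -> w \in T ->
    [/\ (y (other w) <= y m)%R, (y (other (node (node w))) <= y m)%R &
     (y m *+ 2 - y (other w) - y (other (node (node w)))
       = (arc_at w == a)%:R - (arc_at w == b)%:R)%R].
  move=> ow; rewrite inT => /andP[cw /eqP yw]; have yb := y_bal w ow; rewrite yw in yb.
  split; last exact: yb.
    exact/max_m/crossing_other.
  by apply/max_m/crossing_other; rewrite !crossing_node.
clear max_m y_bal; have zNT : z \notin T.
  apply/negP=> /(bal _ oz)[le1 le2]; rewrite zb eqxx abF.
  by case/(mean_of_max (c := true) le1 le2).
have out_a w : w \in outs T -> arc_at w = a.
  rewrite inE => /and3P[wT ow /negP owT]; have cw := over_is_crossing ow.
  have [le1 le2] := bal w ow wT; case: eqP => // _ /(mean_of_max le1 le2)[_ e].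
  by case: owT; rewrite inT e eqxx (crossing_other cw).
have outs_le1 u v : u \in outs T -> v \in outs T -> u = v.
  move=> uO vO; have [ua va] := (out_a _ uO, out_a _ vO).
  move: uO vO; rewrite ![_ \in outs T]inE => /and3P[uT ou ouT] /and3P[vT ov ovT].
  have [cu cv] := (over_is_crossing ou, over_is_crossing ov).
  have : arc_at v == arc_at u by rewrite ua va.
  rewrite (arc_over _ alt ou).
  case/orP=> [uv|].
    case: (other_uniq cu cv uv) => [-> //|e].
    by rewrite e (over_other alt cu) ou in ov.
  have cu2 : crossing (node (node u)) by rewrite !crossing_node.
  case/(other_uniq cu2 cv) => e; last first.
    by rewrite e over_other // over_node2 // ou in ov.
  have [le1] := bal u ou uT; rewrite ua eqxx -e => le2.
  have -> : (a == b) = false by apply/eqP.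
  move: ouT ovT; rewrite !inT !crossing_other //= => /eqP y1 /eqP y2 e12.
  by case: y2; apply: (mean_below_max le1 le2 e12 y1).
have cz := over_is_crossing oz.
have mT : m \in T by rewrite inT cm eqxx.
have out1 : #|outs T| = 1%N.
  apply/eqP; rewrite eqn_leq; apply/andP; split.
    by apply/card_le1_eqP=> u v uO vO; apply: outs_le1.
  rewrite lt0n cards_eq0; apply: contra zNT => /eqP out0.
  exact: outs_eq0 TP mT out0 _ cz.
exists T; split=> //.
have [w wO] : exists w, w \in outs T by apply/set0Pn; rewrite -card_gt0 out1.
have wa := out_a w wO; move: wO; rewrite [_ \in outs T]inE => /and3P[wT ow _].
have cw := over_is_crossing ow.
have : arc_at x == arc_at w by rewrite wa xa.
rewrite arc_over // => /orP[|].
  by case/(other_uniq cw cx) => e; rewrite e // over_other // ow in ox *.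
have cw2 : crossing (node (node w)) by rewrite !crossing_node.
case/(other_uniq cw2 cx) => e; first by rewrite e !(crossing_set_node _ TP).
by rewrite e over_other // over_node2 // ow in ox.
Qed.

Lemma outs_submodular T T' :
  #|outs (T :&: T')| + #|outs (T :|: T')| <= #|outs T| + #|outs T'|.
Proof.
rewrite -!sum1_card ![\sum_(_ in _) _]big_mkcond -!big_split /=.
apply: leq_sum => z _; rewrite !inE; case: (over z); rewrite ?andbF //=.
by case: (z \in T); case: (z \in T'); case: (_ \in T); case: (_ \in T').
Qed.

Lemma card_outs_compl T : crossing_set T ->
  #|outs [set z | crossing z & z \notin T]| = #|outs T|.
Proof.
move=> TP; rewrite [RHS]card_outs_ins //; apply: eq_card => z; rewrite !inE.
have [oz|] := boolP (over z); last by rewrite !andbF.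
have cz := over_is_crossing oz; by rewrite cz crossing_other //= negbK.
Qed.

End Level.

(** * Nontriviality of reduced alternating diagrams *)

Section Nontrivial.
Variable D : diagram.
Implicit Types d x y z w : D.
Implicit Type T : {set D}.
Hypotheses (conn : connected D) (alt : alternating D).

(** The face walk along the outside of the loop goes from one corner of the
    crossing to the opposite one. *)
Lemma loop_nugatory x : over x ->
  other x \in [:: node x; node (node (node x))] -> ~ reduced D.
Proof.
move=> ox; have cx := over_is_crossing ox.
have step d : fconnect (@face D) (node (node (node d))) (edge d).
  by rewrite -{2}(node4 d); apply: fconnect1.
rewrite !inE => /orP[] /eqP e red.
  have := red (node x); rewrite crossing_node => /(_ cx).
  rewrite fconnect_sym ?(connect_trans (step x)) //; last exact: face_inj.
  by rewrite -e other_face.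
have := red x cx; rewrite fconnect_sym; last exact: face_inj.
have cw := crossing_other cx; have := other_face cw; rewrite otherK // => wx.
have := connect_trans (step (other x)) wx.
by rewrite {1}e node4 => ->.
Qed.

(** Otherwise any two arcs are equal in the group of colorings.  Among the sets
    of crossings that at most one segment leaves, take a smallest one.  If it has
    two crossings, the level set of a balanced weighting separates them and, by
    submodularity, cuts it into a smaller set of this kind.  So it consists of
    one crossing, which is nugatory. *)
Lemma alternating_nontrivial d0 : reduced D -> crossing d0 ->
  exists x y : D, Col_gen (arc_at x) <> Col_gen (arc_at y).
Proof.
move=> red cd0; apply: contrapT => all_eq'.
have {all_eq'}all_eq x y : Col_gen (arc_at x) = Col_gen (arc_at y).
  by apply: contrapT => xy; apply: all_eq'; exists x, y.
pose Q T := [&& crossing_set T, T != set0 & #|outs T| <= 1].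
pose X := [set z : D | crossing z].
have QX : Q X.
  apply/and3P; split.
  - by apply/crossing_setP=> z; rewrite !inE crossing_node => ->.
  - by apply/set0Pn; exists d0; rewrite inE.
  - rewrite (_ : outs X = set0) ?cards0 //; apply/setP=> z; rewrite !inE.
    by case: (boolP (crossing z)) => //= cz; rewrite crossing_other ?andbF.
have [S /and3P[SP S_n0 outS] minS] := @arg_minnP _ X Q (fun T => #|T|) QX.
have SP' := elimT (crossing_setP S) SP.
have no_smaller T : Q T -> T \subset S -> T = S.
  by move=> QT TS; apply/eqP; rewrite eqEcard TS minS.
have outs_gt0 T x z : crossing_set T -> x \in T -> crossing z -> z \notin T ->
    0 < #|outs T|.
  move=> TP xT cz; apply: contraNltn; rewrite leqn0 cards_eq0 => /eqP out0.
  exact: (outs_eq0 conn alt TP xT out0).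
have cut_smaller T : crossing_set T -> #|outs T| <= 1 -> S :&: T != set0 ->
    ~~ (S \subset T) -> [exists z, crossing z && (z \notin S :|: T)] -> False.
  move=> TP outT ST_n0 SNT /existsP[z /andP[cz zST]].
  have [w wS] := set0Pn _ S_n0.
  have := outs_gt0 (S :|: T) w z (crossing_setU SP TP).
  rewrite inE wS => /(_ isT cz zST) out_gt0.
  have submod := outs_submodular S T.
  suff /no_smaller STS : Q (S :&: T).
    by case/negP: SNT; rewrite -STS ?subsetIr // subsetIl.
  rewrite /Q crossing_setI // ST_n0 -ltnS -addn1.
  exact: leq_trans (leq_add (leqnn _) out_gt0) (leq_trans submod (leq_add outS outT)).
have [x [xS ox]] : exists x, x \in S /\ over x.
  have [x xS] := set0Pn _ S_n0; have [cx nxS] := SP' x xS.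
  have [ox|ux] := boolP (over x); first by exists x.
  by exists (node x); rewrite over_node1.
have cx := over_is_crossing ox.
have x2S : node (node x) \in S by rewrite !(crossing_set_node _ SP).
have ox2 : over (node (node x)) by rewrite over_node2.
have cx2 := over_is_crossing ox2.
have onlyx z : z \in S -> over z -> z = x \/ z = node (node x).
  move=> zS oz; have [->|zx] := eqVneq z x; first by left.
  have [->|zx2] := eqVneq z (node (node x)); first by right.
  have cz := over_is_crossing oz.
  have ab : arc_at x <> arc_at z.
    move=> /esym/eqP; rewrite (arc_over _ alt ox) => /orP[xz|xz].
      case: (other_uniq cx cz xz) => e; first by rewrite e eqxx in zx.
      by rewrite e (over_other alt cx) ox in oz.
    case: (other_uniq cx2 cz xz) => e; first by rewrite e eqxx in zx2.
    by rewrite e (over_other alt cx2) ox2 in oz.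
  have [T [TP xT zT outT]] :=
    balance_level conn alt (all_eq x z) ab ox oz erefl erefl.
  have [someU|allU] := boolP [exists w, crossing w && (w \notin S :|: T)].
    exfalso; apply: (cut_smaller T); rewrite ?outT //.
      by apply/set0Pn; exists x; rewrite inE xS.
    by apply/negP=> /subsetP/(_ z zS); rewrite (negbTE zT).
  pose T' := [set w | crossing w & w \notin T].
  have T'P : crossing_set T' := crossing_setC TP.
  have outT' : #|outs T'| = 1 by rewrite card_outs_compl.
  have [someU'|allU'] := boolP [exists w, crossing w && (w \notin S :|: T')].
    exfalso; apply: (cut_smaller T'); rewrite ?outT' //.
      by apply/set0Pn; exists z; rewrite !inE zS cz.
    by apply/negP=> /subsetP/(_ x xS); rewrite inE xT andbF.
  exfalso; have TS : T = S.
    apply: no_smaller.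
      by rewrite /Q TP outT andbT; apply/set0Pn; exists x.
    apply/subsetP=> w wT; apply: contraNT allU' => wS.
    apply/existsP; exists w; rewrite !inE negb_or wS wT andbF.
    by have [-> _] := elimT (crossing_setP T) TP w wT.
  by rewrite TS zS in zT.
have [u [uS ou uO]] : exists u, [/\ u \in S, over u & u \notin outs S].
  have [xO|] := boolP (x \in outs S); last by exists x.
  exists (node (node x)); split=> //; apply/negP=> x2O.
  have /card_le1_eqP/(_ _ _ xO x2O) e := outS.
  by have := cx; rewrite /crossing {1}e eqxx.
have ouS : other u \in S by move: uO; rewrite !inE uS ou /= negbK.
have cu := over_is_crossing ou.
have uu : over (node (other u)).
  by rewrite over_node1 ?crossing_other // (over_other alt cu) ou.
apply: (loop_nugatory ou _ red).
have [_ noS] := SP' _ ouS.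
rewrite -[other u]node4.
by case: (onlyx u uS ou) (onlyx _ noS uu) => -> [] ->;
  rewrite !inE ?node4 !eqxx ?orbT.
Qed.

End Nontrivial.

(** * From level sets to cuts *)

Section LevelCut.
Variable D : diagram.
Implicit Types u x y z w : D.
Hypotheses (conn : connected D) (alt : alternating D).

(** The cut goes through the segment leaving [T] and the one entering it.  A
    marked point is put on the side of the upper end of its segment, so that
    these two segments are cut next to their lower ends. *)
Lemma outs_cut (T : {set D}) t : crossing_set T -> t \in T -> #|outs T| = 1 ->
  exists (S : {set D}) (p p' : D),
    [/\ cut S p p', forall z, crossing z -> (z \in S) = (z \in T),
        (forall z, crossing z -> segment p z -> over z = (z \in S)) &
        (forall z, crossing z -> segment p' z -> over z = (z \notin S))].
Proof.
move=> TP tT outT; have TP' := elimT (crossing_setP T) TP.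
have [ct _] := TP' t tT.
have ex_over z : exists2 u, over u & segment z u.
  have [d cd zd] := segment_crossing z conn ct.
  have [od|ud] := boolP (over d); first by exists d.
  exists (other d); first by rewrite over_other.
  exact: segment_trans zd (segment_other cd).
pose start z := odflt z [pick u | over u && segment z u].
have startE z u : over u -> segment z u -> start z = u.
  move=> ou zu; rewrite /start; case: pickP => [v /andP[ov zv]|no]; last first.
    by have := no u; rewrite ou zu.
  have uv : segment u v by apply: segment_trans zv; rewrite segment_sym.
  have cu := over_is_crossing ou; case: (other_uniq cu (over_is_crossing ov) uv) => //= e.
  by rewrite e over_other // ou in ov.
have [S inS] : exists S : {set D}, forall z,
    (z \in S) = if crossing z && ~~ over z then z \in T else start z \in T.
  by eexists [set z | _] => z; rewrite inE.
have S_T z : crossing z -> (z \in S) = (z \in T).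
  move=> cz; rewrite inS cz /=; case: ifP => // /negbFE oz.
  by rewrite (startE z z) // segment_refl.
have S_start z u : over u -> segment u z -> z != other u ->
    (z \in S) = (u \in T).
  move=> ou uz zu; have cu := over_is_crossing ou.
  have [cz|mz] := boolP (crossing z).
    by case: (other_uniq cu cz uz) => e; [rewrite e S_T|rewrite e eqxx in zu].
  by rewrite inS (negbTE mz) (startE z u) // segment_sym.
have /eqP/cards1P[o outE] := outT.
have /eqP/cards1P[o' inE'] : #|ins T| = 1 by rewrite -card_outs_ins.
have /setP/(_ o) := outE; rewrite !inE eqxx => /and3P[oT oo owT].
have /setP/(_ o') := inE'; rewrite !inE eqxx => /and3P[oo' o'T ow'T].
have [co co'] := (over_is_crossing oo, over_is_crossing oo').
have [cw cw'] := (crossing_other co, crossing_other co').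
have edge_other u : over u -> (edge (other u) \in S) = (u \in T).
  move=> ou; apply: S_start => //; last exact: edge_neq.
  apply: segment_trans (segment_edge _).
  exact/segment_other/over_is_crossing.
exists S, (edge (other o)), (other o').
have p_end z : crossing z -> segment (edge (other o)) z -> z = o \/ z = other o.
  move=> cz pz; apply: other_uniq => //.
  apply: segment_trans pz; apply: segment_trans (segment_edge _).
  exact: segment_other.
have p'_end z : crossing z -> segment (other o') z -> z = o' \/ z = other o'.
  move=> cz pz; apply: other_uniq => //.
  by apply: segment_trans pz; apply: segment_other.
split=> //; last 2 first.
- by move=> z cz /(p_end z cz)[]->; rewrite ?(over_other alt) ?S_T ?oo ?oT ?(negbTE owT).
- move=> z cz /(p'_end z cz)[]->; rewrite ?(over_other alt) ?S_T ?oo' ?o'T //.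
  by rewrite ow'T.
split.
- move=> x xS; have [cx|mx] := boolP (crossing x).
    by rewrite S_T ?crossing_node // crossing_set_node // -S_T.
  have [u ou xu] := ex_over x.
  move: xS; rewrite !inS crossing_node (negbTE mx) /= (startE x u) //.
  rewrite (startE (node x) u) //; apply: segment_trans xu.
  by rewrite segment_sym segment_node.
- by rewrite edge_other.
- by rewrite S_T.
- apply/eqP=> e; have := p_end _ cw'; rewrite e segment_refl => /(_ isT)[e'|e'].
    by have := over_other alt co'; rewrite e' oo oo'.
  by have := edge_neq (other o); rewrite e e' eqxx.
- by rewrite edgeK S_T.
- by rewrite edge_other.
move=> x xS xp xp'; have [u ou xu] := ex_over x.
have cu := over_is_crossing ou.
have ux : segment u x by rewrite segment_sym.
have uex : segment u (edge x) := segment_trans ux (segment_edge _).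
have [exu|exu] := eqVneq (edge x) (other u).
  have xNu : x != other u by rewrite -exu eq_sym edge_neq.
  have uT : u \in T by rewrite -(S_start x u).
  rewrite exu S_T ?crossing_other //; apply: contraNT xp => ouT.
  have : u \in outs T by rewrite !inE uT ou.
  by rewrite outE inE => /eqP uo; rewrite -uo -exu edgeK.
rewrite (S_start _ u) //; have [xu'|xNu] := eqVneq x (other u); last first.
  by rewrite -(S_start x u).
apply: contraNT xp' => uT; have : u \in ins T.
  by rewrite !inE ou uT -xu' -S_T // xu' crossing_other.
by rewrite inE' inE => /eqP <-; rewrite xu'.
Qed.

End LevelCut.

(** * Colorings and tangle replacement *)

Import GRing.Theory.

Section Kei.
Variable V : zmodType.
Implicit Types a b c : V.
Local Open Scope ring_scope.

(** The reflection of [a] in [b], which makes an abelian group an involutory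
    quandle; the three laws below match the three Reidemeister moves. *)
Definition kei b a := b *+ 2 - a.

Lemma kei_idem a : kei a a = a.
Proof. by rewrite /kei mulr2n addrK. Qed.

Lemma keiK b : involutive (kei b).
Proof. by move=> a; rewrite /kei opprB addrC subrK. Qed.

Lemma kei_conj c b a : kei (kei c b) a = kei c (kei b (kei c a)).
Proof.
rewrite /kei mulrnBl !opprB; move: (c *+ 2)%R (b *+ 2)%R => C B.
by rewrite mulr2n -!addrA; congr (_ + (_ + _)); rewrite addrC.
Qed.

End Kei.

Section DartColoring.
Variables (V : zmodType) (D : diagram).
Implicit Type c : D -> V.

(** A coloring of the darts with values in any abelian group.  Being local
    conditions on edges and vertices, colorings of darts can be changed in a
    part of the diagram, which colorings of arcs do not allow directly. *)
Definition vertex_ok c (d : D) : Prop :=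
  (~~ crossing d -> c (node d) = c d) /\
  (over d -> c (node (node d)) = c d /\
             c (node (node (node d))) = kei (c d) (c (node d))).

Definition dart_coloring c : Prop :=
  (forall d, c (edge d) = c d) /\ (forall d, vertex_ok c d).

Lemma marked_vertexP c m : ~~ crossing m -> c (node m) = c m ->
  vertex_ok c m /\ vertex_ok c (node m).
Proof.
move=> mm cm.
have nover d : ~~ crossing d -> over d -> False by move=> md /over_is_crossing; apply/negP.
split; split=> [|/nover[]//]; rewrite ?crossing_node ?marked_node2 //.
Qed.

Lemma crossing_vertexP c x : crossing x ->
    (over x -> c (node (node x)) = c x /\
               c (node (node (node x))) = kei (c x) (c (node x))) ->
    (~~ over x -> c (node (node (node x))) = c (node x) /\
                  c x = kei (c (node x)) (c (node (node x)))) ->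
  forall d, d \in [:: x; node x; node (node x); node (node (node x))] ->
  vertex_ok c d.
Proof.
move=> cx ov un d; rewrite !inE => d_in.
have cd : crossing d by case/or4P: d_in => /eqP->; rewrite ?crossing_node.
split=> [|od]; first by rewrite cd.
case/or4P: d_in od => /eqP->.
- exact: ov.
- by rewrite !node4 over_node1 // => /un[-> ->].
- by rewrite !node4 over_node2 // => /ov[-> ->]; rewrite keiK.
- rewrite !node4 over_node3 // => /un[-> ->]; split=> //.
  by rewrite keiK.
Qed.

Lemma dart_coloring_corner c x v : dart_coloring c -> crossing x ->
    c (node (node x)) = v -> c (node (node (node x))) = v ->
  c x = v /\ c (node x) = v.
Proof.
move=> [_ cV] cx x2 x3; have [ox|ux] := boolP (over x).
  have [_ /(_ ox) []] := cV x; rewrite x2 x3 => <- /(congr1 (kei v)).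
  by rewrite keiK kei_idem => <-.
have [_] := cV (node x); rewrite over_node1 // => /(_ ux).
by rewrite x2 x3 node4 => -[<- ->]; rewrite kei_idem.
Qed.

End DartColoring.

Definition only_constant (V : zmodType) (D : diagram) : Prop :=
  forall c : D -> V, dart_coloring c -> forall x y, c x = c y.

Lemma assign (T : eqType) (V : Type) (v0 : V) (s : seq T) (cs : seq V) :
  uniq s -> size s = size cs -> exists f : T -> V, [seq f x | x <- s] = cs.
Proof.
move=> s_uniq s_size; exists (fun x => nth v0 cs (index x s)).
apply: (@eq_from_nth _ v0); rewrite size_map // => i i_lt.
have x0 : T by case: s i_lt {s_uniq s_size} => //.
by rewrite (nth_map x0) // index_uniq.
Qed.

Section Tangles.

(** These conditions keep the part of [D] outside of the tangle closed under
    [edge] and [node], so that both sides of a replacement play the same role. *)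
Definition tangle (D : diagram) (ends inner : seq D) : Prop :=
  {in inner, forall d, edge d \in inner} /\
  {in ends ++ inner, forall d, node d \in ends ++ inner}.

Lemma replaces_sym (D D' : diagram) (ends inner : seq D)
    (ends' inner' : seq D') :
  tangle ends inner -> replaces ends inner ends' inner' ->
  replaces ends' inner' ends inner.
Proof.
move=> [eI nE] [uD uD' [h [h_inj h_im h_ends h_edge h_node]]].
split=> //.
have [d0 _] : exists d0 : D, d0 \in D by apply/card_gt0P/dart_gt0.
pose g d' := odflt d0 [pick d | (d \notin inner) && (h d == d')].
have gK d : d \notin inner -> g (h d) = d.
  move=> dI; rewrite /g; case: pickP => [u /andP[uI /eqP]|/(_ d)] /=.
    by apply: h_inj; rewrite inE.
  by rewrite dI eqxx.
have hK d' : d' \notin inner' -> h (g d') = d' /\ g d' \notin inner.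
  by case/h_im=> d dI <-; rewrite gK.
have notI d : d \in ends -> d \notin inner.
  by move: uD; rewrite cat_uniq => /and3P[_ /hasPn disj _] /(contraL (disj d)); apply.
have edgeI d : d \notin inner -> edge d \notin inner.
  by apply: contra => /eI; rewrite edgeK.
exists g; split.
- by move=> u v; rewrite !inE => /hK[eu _] /hK[ev _] guv; rewrite -eu guv ev.
- move=> d; split=> [dI|[d' d'I <-]]; last by case: (hK d' d'I).
  by exists (h d); [apply/h_im; exists d|rewrite gK].
- rewrite -h_ends -map_comp -[RHS]map_id; apply/eq_in_map => d /notI dI /=.
  exact: gK.
- move=> d' /=; rewrite inE => d'I; have [e dI] := hK d' d'I.
  by rewrite -{1}e -h_edge ?inE // gK ?edgeI.
- move=> d'; rewrite !inE mem_cat negb_or => /andP[d'E d'I].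
  have [e dI] := hK d' d'I; have dE : g d' \notin ends ++ inner.
    rewrite mem_cat negb_or dI andbT; apply: contra d'E => gE.
    by rewrite -e -h_ends map_f.
  have [hn ho] := h_node _ dE; split; last by rewrite -{1}e -ho.
  rewrite -{1}e -hn gK //.
  have : node (g d') \notin ends ++ inner.
    by apply: contra dE => /nE/nE/nE; rewrite node4.
  by rewrite mem_cat negb_or => /andP[].
Qed.

Variables (V : zmodType) (D D' : diagram).
Variables (ends inner : seq D) (ends' inner' : seq D').

(** A coloring of [D] is carried unchanged outside of the tangle to a coloring
    of [D'], so it is constant there; constancy spreads back over the old tangle
    because each of its inner corners faces two ends. *)
Lemma only_constant_replaces :
    tangle ends inner -> tangle ends' inner' ->
    replaces ends inner ends' inner' ->
    (forall d, d \in inner -> exists2 x, d \in [:: x; node x] &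
       [/\ crossing x, node (node x) \notin inner &
           node (node (node x)) \notin inner]) ->
    (forall c : D -> V, dart_coloring c -> exists new : D' -> V,
       [/\ map new ends' = map c ends,
           {in inner', forall d, new (edge d) = new d} &
           {in ends' ++ inner', forall d, vertex_ok new d}]) ->
  only_constant V D' -> only_constant V D.
Proof.
move=> [eI nE] [eI' nE'] [uD uD' [h [h_inj h_im h_ends h_edge h_node]]].
move=> corners ext constD' c cC; have [cE cV] := cC.
have [new [newE newI newV]] := ext c cC.
have [d0 _] : exists d0 : D, d0 \in D by apply/card_gt0P/dart_gt0.
pose g d' := odflt d0 [pick d | (d \notin inner) && (h d == d')].
have gK d : d \notin inner -> g (h d) = d.
  move=> dI; rewrite /g; case: pickP => [u /andP[uI /eqP]|/(_ d)] /=.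
    by apply: h_inj; rewrite inE.
  by rewrite dI eqxx.
have notI d : d \in ends -> d \notin inner.
  by move: uD; rewrite cat_uniq => /and3P[_ /hasPn disj _] /(contraL (disj d)); apply.
have edgeI d : d \notin inner -> edge d \notin inner.
  by apply: contra => /eI; rewrite edgeK.
have nodeEI d : d \notin ends ++ inner -> node d \notin ends ++ inner.
  by apply: contra => /nE/nE/nE; rewrite node4.
have notEI d : d \notin ends ++ inner -> d \notin inner.
  by rewrite mem_cat negb_or => /andP[].
pose c' d' := if d' \in ends' ++ inner' then new d' else c (g d').
have c'h d : d \notin inner -> c' (h d) = c d.
  move=> dI; rewrite /c'; case: ifP => [|_]; last by rewrite gK.
  have hdI : h d \notin inner' by apply/h_im; exists d.
  rewrite mem_cat (negbTE hdI) orbF -h_ends => /mapP[u uE hdu].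
  have -> : d = u := h_inj d u dI (notI u uE) hdu.
  move: newE; rewrite -h_ends -map_comp => /eq_in_map; exact.
have outE d : d \notin ends ++ inner -> h d \notin ends' ++ inner'.
  rewrite !mem_cat !negb_or => /andP[dE dI]; apply/andP; split; last first.
    by apply/h_im; exists d.
  rewrite -h_ends; apply: contra dE => /mapP[u uE hdu].
  by have -> : d = u := h_inj d u dI (notI u uE) hdu.
have c'C : dart_coloring c'.
  split=> d'.
    have [d'I|/h_im[d dI <-]] := boolP (d' \in inner').
      by rewrite /c' !mem_cat d'I eI' // !orbT newI.
    by rewrite -h_edge ?inE // !c'h ?edgeI // cE.
  have [d'E|d'E] := boolP (d' \in ends' ++ inner').
    have n1 := nE' _ d'E; have n2 := nE' _ n1; have n3 := nE' _ n2.
    by have := newV _ d'E; rewrite /vertex_ok /c' d'E n1 n2 n3.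
  have /h_im[d dI hd] : d' \notin inner'.
    by move: d'E; rewrite mem_cat negb_or => /andP[].
  have dE : d \notin ends ++ inner.
    apply: contra d'E; rewrite !mem_cat (negbTE dI) orbF => dE.
    by rewrite -hd -h_ends map_f.
  have [n1 n2] := (nodeEI _ dE, nodeEI _ (nodeEI _ dE)); have n3 := nodeEI _ n2.
  have [h1 o1] := h_node _ dE; have [h2 _] := h_node _ n1.
  have [h3 _] := h_node _ n2.
  have cross : crossing d' = crossing d.
    rewrite /crossing -hd -h1 -h2; congr (~~ _); apply/eqP/eqP => [|-> //].
    by apply: h_inj; rewrite inE notEI.
  have := cV d; rewrite /vertex_ok cross -hd -o1 -h1 -h2 -h3.
  by rewrite !c'h ?notEI.
have const u v : u \notin inner -> v \notin inner -> c u = c v.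
  by move=> uI vI; rewrite -!c'h //; apply: constD'.
have near u v : v \notin inner -> c u = c v.
  move=> vI; have [uI|uI] := boolP (u \in inner); last exact: const.
  have [x ux [cx x2 x3]] := corners u uI.
  have [] := dart_coloring_corner cC cx (const _ v x2 vI) (const _ v x3 vI).
  by move: ux; rewrite !inE => /orP[] /eqP->.
move=> u v; have [vI|vI] := boolP (v \in inner); last exact: near.
have [x _ [_ x2 _]] := corners v vI.
by rewrite (near u _ x2) (near v _ x2).
Qed.

End Tangles.

(** * The first two Reidemeister moves *)

Import GRing.Theory.

Section Moves.
Variable V : zmodType.

Lemma crossing_colors (D : diagram) (c : D -> V) x :
    dart_coloring c -> crossing x ->
  if over x then c (node (node x)) = c x /\
                 c (node (node (node x))) = kei (c x) (c (node x))
  else c (node (node (node x))) = c (node x) /\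
       c x = kei (c (node x)) (c (node (node x))).
Proof.
move=> [_ cV] cx; case: ifP => [ox|/negbT ux]; first exact: (cV x).2.
by have := (cV (node x)).2; rewrite over_node1 // node4 => /(_ ux).
Qed.

Lemma crossing_vertex_if (D : diagram) (c : D -> V) x : crossing x ->
    (if over x then c (node (node x)) = c x /\
                    c (node (node (node x))) = kei (c x) (c (node x))
     else c (node (node (node x))) = c (node x) /\
          c x = kei (c (node x)) (c (node (node x)))) ->
  [/\ vertex_ok c x, vertex_ok c (node x), vertex_ok c (node (node x)) &
      vertex_ok c (node (node (node x)))].
Proof.
move=> cx cif; have ok : forall d,
    d \in [:: x; node x; node (node x); node (node (node x))] -> vertex_ok c d.
  by apply: crossing_vertexP => // ox; move: cif; rewrite ?ox ?(negbTE ox).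
by split; apply: ok; rewrite !inE eqxx ?orbT.
Qed.

Lemma ends_notin_inner (T : eqType) (ends inner : seq T) d :
  uniq (ends ++ inner) -> d \in ends -> d \notin inner.
Proof.
by rewrite cat_uniq => /and3P[_ /hasPn disj _] /(contraL (disj d)); apply.
Qed.

Lemma end_crossing (D : diagram) (ends inner : seq D) (x : D) :
    uniq (ends ++ inner) -> node (node x) \in ends -> x \in inner ->
  crossing x.
Proof.
move=> uD xE xI; have := ends_notin_inner uD xE.
by apply: contraNN => /eqP->.
Qed.

Lemma isomorphic_only_constant D D' : isomorphic D D' ->
  only_constant V D <-> only_constant V D'.
Proof.
have tangle0 E : @tangle E [::] [::] by split.
have half E E' : isomorphic E E' -> only_constant V E' -> only_constant V E.
  move=> iso; apply: (@only_constant_replaces V E E' [::] [::] [::] [::]) => //.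
  by move=> c _; exists (fun _ => 0%R).
by move=> iso; split; apply: half => //; apply: replaces_sym iso.
Qed.

Lemma subdivides_only_constant D D' : subdivides D D' ->
  only_constant V D <-> only_constant V D'.
Proof.
move=> [h [m [mm em h_inj h_im hP]]].
have nm : ~~ crossing (node m) by rewrite crossing_node.
have edge_m e : e \in [:: m; node m] -> edge e \notin [:: m; node m].
  rewrite !inE negb_or => /orP[]/eqP->; rewrite edge_neq ?em ?andbT //.
  by apply: contra em => /eqP enm; rewrite -{1}enm edgeK.
have edge_h d : h (edge d) =
    let e := edge (h d) in if e \in [:: m; node m] then edge (node e) else e.
  by have [] := hP d.
have crossing_h d : crossing (h d) = crossing d.
  by rewrite /crossing; have [<- _ _] := hP d; have [<- _ _] := hP (node d);
     rewrite (inj_eq h_inj).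
split=> constD c cC; have [cE cV] := cC.
  have cm e : e \in [:: m; node m] -> c (node e) = c e.
    rewrite !inE => /orP[]/eqP->; first exact: (cV m).1.
    by rewrite marked_node2 // (cV m).1.
  have chC : dart_coloring (c \o h).
    split=> d; rewrite /= ?edge_h /=.
      by case: ifP => e_in; rewrite !cE // cm // cE.
    have := cV (h d); rewrite /vertex_ok crossing_h /=.
    have [h1 <- _] := hP d; have [h2 _ _] := hP (node d).
    by have [h3 _ _] := hP (node (node d)); rewrite h3 h2 h1.
  have const u v : u \notin [:: m; node m] -> v \notin [:: m; node m] ->
      c u = c v.
    by rewrite -!h_im => /codomP[u' ->] /codomP[v' ->]; apply: constD chC u' v'.
  have out u : exists2 u', u' \notin [:: m; node m] & c u = c u'.
    have [uI|uI] := boolP (u \in [:: m; node m]); last by exists u.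
    by exists (edge u); [apply: edge_m|rewrite cE].
  move=> u v; have [u' u'I ->] := out u; have [v' v'I ->] := out v.
  exact: const.
have [d0 _] : exists d0 : D, d0 \in D by apply/card_gt0P/dart_gt0.
pose g d' := odflt d0 [pick d | h d == d'].
have gK d : g (h d) = d.
  rewrite /g; case: pickP => [u /eqP/h_inj//|/(_ d)] /=.
  by rewrite eqxx.
pose c' d' := if d' \in [:: m; node m] then c (g (edge m)) else c (g d').
have hN d : h d \notin [:: m; node m] by rewrite -h_im codom_f.
have c'h d : c' (h d) = c d by rewrite /c' (negbTE (hN d)) gK.
have c'm e : e \in [:: m; node m] -> c' e = c (g (edge m)).
  by rewrite /c' => ->.
have [dm hdm] : exists dm, h dm = edge m.
  have : edge m \in codom h by rewrite h_im edge_m // inE eqxx.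
  by case/codomP=> dm ->; exists dm.
have hedm : h (edge dm) = edge (node m).
  by rewrite edge_h hdm edgeK /= inE eqxx.
have c'C : dart_coloring c'.
  split=> d'.
    have [|] := boolP (d' \in [:: m; node m]); last first.
      rewrite -h_im => /codomP[d ->].
      have := edge_h d => /=; case: ifP => [e_in e|_ <-]; last by rewrite !c'h cE.
      rewrite (c'm _ e_in) -hdm gK c'h.
      move: e_in e; rewrite !inE => /orP[] /eqP hd e.
        by congr c; apply: h_inj; rewrite hdm -hd edgeK.
      rewrite -(cE dm); congr c; apply: h_inj.
      by rewrite hedm -hd edgeK.
    move=> d'I; rewrite (c'm _ d'I) -hdm gK.
    move: d'I; rewrite !inE => /orP[]/eqP->; first by rewrite -hdm c'h.
    by rewrite -hedm c'h cE.
  have [d'I|] := boolP (d' \in [:: m; node m]).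
    have cm : c' (node m) = c' m by rewrite !c'm // !inE eqxx ?orbT.
    have [] := marked_vertexP mm cm.
    by move: d'I; rewrite !inE => /orP[]/eqP->.
  rewrite -h_im => /codomP[d ->]; have := cV d.
  rewrite /vertex_ok crossing_h; have [h1 -> _] := hP d.
  have [h2 _ _] := hP (node d); have [h3 _ _] := hP (node (node d)).
  by rewrite -h1 -h2 -h3 !c'h.
by move=> u v; rewrite -!c'h; apply: constD.
Qed.

Lemma reidemeister1_only_constant D D' : reidemeister1 D D' ->
  only_constant V D <-> only_constant V D'.
Proof.
move=> [m [x [mm ex rep]]]; have [_ uD' _] := rep.
have cx : crossing x by apply: end_crossing uD' _ _; rewrite !inE eqxx.
have tD : tangle [:: m; node m] [::].
  by split=> // d; rewrite !inE => /orP[]/eqP->; rewrite ?marked_node2 ?eqxx ?orbT.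
have tD' : tangle [:: node (node x); node (node (node x))] [:: x; node x].
  split=> d; rewrite !inE => d_in.
    by case/orP: d_in => /eqP->; rewrite -?ex ?edgeK ex eqxx ?orbT.
  by case/or4P: d_in => /eqP->; rewrite ?node4 eqxx ?orbT.
split.
  apply: only_constant_replaces (replaces_sym tD rep) _ _ => //.
    move=> d d_in; exists x => //; split=> //; apply: ends_notin_inner uD' _;
      by rewrite !inE eqxx ?orbT.
  move=> c cC; exists (fun=> c x).
  have cnx : c (node x) = c x by rewrite -ex cC.1.
  have [e2 e3] : c (node (node x)) = c x /\ c (node (node (node x))) = c x.
    have := crossing_colors cC cx; rewrite cnx kei_idem.
    case: ifP => _ [-> e]; first by rewrite e.
    by move: e => /(congr1 (kei (c x))); rewrite keiK kei_idem.
  split=> //=; first by rewrite e2 e3.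
  by move=> d _; split=> // _; rewrite kei_idem.
apply: only_constant_replaces rep _ _ => //.
move=> c [cE cV]; exists (fun=> c m).
have [cm _] := cV m; rewrite /= cm //.
by split=> // d _; split=> // _; rewrite kei_idem.
Qed.

Lemma reidemeister2_only_constant D D' : reidemeister2 D D' ->
  only_constant V D <-> only_constant V D'.
Proof.
move=> [m1 [m2 [x [y [/andP[mm1 mm2] [ex ey] ov rep]]]]]; have [uD uD' _] := rep.
have cx : crossing x by apply: end_crossing uD' _ _; rewrite !inE eqxx ?orbT.
have cy : crossing y by apply: end_crossing uD' _ _; rewrite !inE eqxx ?orbT.
have oxy : over x = ~~ over y by rewrite -ov over_node1 // negbK.
have exn : edge (node x) = y by rewrite -ey edgeK.
have eyn : edge (node y) = x by rewrite -ex edgeK.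
have tD : tangle [:: m1; node m1; m2; node m2] [::].
  by split=> // d; rewrite !inE => /or4P[]/eqP->; rewrite ?marked_node2 ?eqxx ?orbT.
have tD' : tangle [:: node (node (node x)); node (node y);
                      node (node x); node (node (node y))]
                  [:: x; node x; y; node y].
  split=> d; rewrite !inE => d_in.
    by case/or4P: d_in => /eqP->; rewrite ?ex ?ey ?exn ?eyn eqxx ?orbT.
  by move: d_in; do ?[case/predU1P=> [->|]]; last move/eqP->;
     rewrite ?node4 eqxx ?orbT.
split.
  apply: only_constant_replaces (replaces_sym tD rep) _ _ => //.
    move=> d; rewrite !inE => d_in.
    have notin z : z \in [:: node (node (node x)); node (node y);
        node (node x); node (node (node y))] -> z \notin [:: x; node x; y; node y].
      exact: ends_notin_inner uD'.
    have corner z : crossing z -> z \in [:: x; y] ->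
        [/\ crossing z, node (node z) \notin [:: x; node x; y; node y] &
          node (node (node z)) \notin [:: x; node x; y; node y]].
      move=> cz z_in; rewrite !inE in z_in.
      case/orP: z_in => /eqP->; split=> //; apply: notin;
        by rewrite !inE eqxx ?orbT.
    have [cnx cny] : _ /\ _ := conj (corner x cx (mem_head _ _))
                                    (corner y cy (mem_last x [:: y])).
    by case/or4P: d_in => /eqP->; [exists x|exists x|exists y|exists y] => //;
       rewrite !inE eqxx ?orbT.
  move=> c cC; have [cE cV] := cC.
  have [new] := assign 0%R (cs := [:: c (node (node (node x))); c (node (node y));
                        c (node (node x)); c (node (node (node y)))]) uD erefl.
  move=> [n1 n1' n2 n2']; exists new.
  have [c1 c2] : c (node (node (node x))) = c (node (node y)) /\
                 c (node (node x)) = c (node (node (node y))).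
    have := crossing_colors cC cx; have := crossing_colors cC cy.
    have := cE x; have := cE y; rewrite ex ey oxy => -> ->.
    case: (over y) => /= -[y1 y2] [x1 x2]; split.
    - by rewrite x1 y1.
    - by rewrite y2 x2 keiK.
    - by rewrite x2 y2 keiK.
    - by rewrite x1 y1.
  have [ok1 ok1'] : vertex_ok new m1 /\ vertex_ok new (node m1).
    by apply: marked_vertexP => //; rewrite n1 n1'.
  have [ok2 ok2'] : vertex_ok new m2 /\ vertex_ok new (node m2).
    by apply: marked_vertexP => //; rewrite n2 n2'.
  split=> //; first by rewrite /= n1 n1' n2 n2'.
  by move=> d; rewrite !inE => /or4P[] /eqP->.
apply: only_constant_replaces rep _ _ => //.
move=> c cC; have [cE cV] := cC.
have c1 : c (node m1) = c m1 by apply: (cV m1).1.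
have c2 : c (node m2) = c m2 by apply: (cV m2).1.
pose X := if over y then kei (c m1) (c m2) else c m2.
pose N := if over y then c m1 else kei (c m2) (c m1).
have [new] := assign 0%R
  (cs := [:: c m1; c m1; c m2; c m2; X; N; N; X]) uD' erefl.
move=> [nx3 ny2 nx2 ny3 nx0 nx1 ny0 ny1]; exists new.
have [ok0 ok1 ok2 ok3] : [/\ vertex_ok new x, vertex_ok new (node x),
    vertex_ok new (node (node x)) & vertex_ok new (node (node (node x)))].
  apply: crossing_vertex_if => //; rewrite nx0 nx1 nx2 nx3 oxy /X /N.
  by case: (over y); rewrite /= ?keiK.
have [ok0' ok1' ok2' ok3'] : [/\ vertex_ok new y, vertex_ok new (node y),
    vertex_ok new (node (node y)) & vertex_ok new (node (node (node y)))].
  apply: crossing_vertex_if => //; rewrite ny0 ny1 ny2 ny3 /X /N.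
  by case: (over y); rewrite /= ?keiK.
split.
- by rewrite /= nx3 ny2 nx2 ny3 c1 c2.
- move=> d; rewrite !inE => /or4P[]/eqP->;
  by rewrite ?ex ?ey ?exn ?eyn ?nx0 ?nx1 ?ny0 ?ny1.
- by move=> d; rewrite !inE; do ?[case/predU1P=> [->|]]; last move/eqP->.
Qed.

End Moves.

(** * The third Reidemeister move *)

Import GRing.Theory.

Lemma replaces_rot n (D D' : diagram) (ends inner : seq D)
    (ends' inner' : seq D') :
  replaces ends inner ends' inner' ->
  replaces (rot n ends) inner (rot n ends') inner'.
Proof.
move=> [uD uD' [h [h_inj h_im h_ends h_edge h_node]]].
have rot_uniq' (T : eqType) (s t : seq T) : uniq (s ++ t) -> uniq (rot n s ++ t).
  by rewrite (@perm_uniq _ _ (s ++ t)) // perm_cat2r perm_rot.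
split; [exact: rot_uniq'|exact: rot_uniq'|exists h; split=> //].
  by rewrite map_rot h_ends.
by move=> d; rewrite inE mem_cat mem_rot -mem_cat => dE; apply: h_node.
Qed.

Lemma triangle_tangle (D : diagram) (x y z : D) (ends : seq D) :
    edge x = node y -> edge y = node z -> edge z = node x ->
    perm_eq ends [:: node (node x); node (node (node x));
                     node (node y); node (node (node y));
                     node (node z); node (node (node z))] ->
  tangle ends [:: x; node x; y; node y; z; node z].
Proof.
move=> ex ey ez pe; have exn : edge (node x) = z by rewrite -ez edgeK.
have eyn : edge (node y) = x by rewrite -ex edgeK.
have ezn : edge (node z) = y by rewrite -ey edgeK.
split=> d.
  rewrite !inE; do ?[case/predU1P=> [->|]]; last move/eqP->;
    by rewrite ?ex ?ey ?ez ?exn ?eyn ?ezn eqxx ?orbT.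
rewrite !mem_cat !(perm_mem pe) !inE -!orbA.
by do ?[case/predU1P=> [->|]]; last move/eqP->; rewrite ?node4 eqxx ?orbT.
Qed.

(** The configuration of the third move is its own inverse, up to a half-turn
    that rotates the list of ends by three. *)
Lemma reidemeister3_sym D D' : reidemeister3 D D' -> reidemeister3 D' D.
Proof.
move=> [x [y [z [x' [y' [z' [[ex ey ez] e' [ox oy oz] not3 rep]]]]]]].
exists x', y', z', x, y, z; split=> //; first by rewrite ox oy oz.
exact: (replaces_rot 3 (replaces_sym (triangle_tangle ex ey ez (perm_refl _)) rep)).
Qed.

Section Move3.
Variable V : zmodType.

Lemma reidemeister3_half D D' : reidemeister3 D D' ->
  only_constant V D' -> only_constant V D.
Proof.
move=> [x [y [z [x' [y' [z' [[ex ey ez] [ex' ey' ez'] [ox oy oz] not3 rep]]]]]]].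
have [uD uD' _] := rep.
have cx : crossing x by apply: end_crossing uD _ _; rewrite !inE eqxx ?orbT.
have cy : crossing y by apply: end_crossing uD _ _; rewrite !inE eqxx ?orbT.
have cz : crossing z by apply: end_crossing uD _ _; rewrite !inE eqxx ?orbT.
have cx' : crossing x' by apply: end_crossing uD' _ _; rewrite !inE eqxx ?orbT.
have cy' : crossing y' by apply: end_crossing uD' _ _; rewrite !inE eqxx ?orbT.
have cz' : crossing z' by apply: end_crossing uD' _ _; rewrite !inE eqxx ?orbT.
have exn : edge (node x') = z' by rewrite -ez' edgeK.
have eyn : edge (node y') = x' by rewrite -ex' edgeK.
have ezn : edge (node z') = y' by rewrite -ey' edgeK.
apply: only_constant_replaces rep _ _.
- exact: triangle_tangle (perm_refl _).
- apply: triangle_tangle => //.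
  by rewrite -(perm_rot 3) /= perm_refl.
- move=> d d_in; rewrite !inE in d_in.
  have corner w : crossing w -> w \in [:: x; y; z] ->
      [/\ crossing w, node (node w) \notin [:: x; node x; y; node y; z; node z] &
        node (node (node w)) \notin [:: x; node x; y; node y; z; node z]].
    move=> cw w_in; rewrite !inE in w_in.
    by case/or3P: w_in => /eqP->; split=> //; apply: ends_notin_inner uD _;
       rewrite !inE eqxx ?orbT.
  have in3 : [/\ x \in [:: x; y; z], y \in [:: x; y; z] & z \in [:: x; y; z]].
    by rewrite !inE !eqxx !orbT.
  have [x3 y3 z3] := in3.
  have [cornx corny cornz] := And3 (corner x cx x3) (corner y cy y3) (corner z cz z3).
  move: d_in; do ?[case/predU1P=> [->|]]; last move/eqP->;
    [exists x|exists x|exists y|exists y|exists z|exists z] => //;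
    by rewrite !inE eqxx ?orbT.
move=> c cC; have [cE _] := cC.
pose a1 := c (node (node x)); pose a2 := c (node (node (node x))).
pose b1 := c (node (node y)); pose b2 := c (node (node (node y))).
pose e1 := c (node (node z)); pose e2 := c (node (node (node z))).
(* the colors of the three edges of the new triangle; at each of its ends
   where an edge is above, it has the color of the end that prolongs it *)
pose X := if over x then b2 else if over y then kei e1 b2 else a1.
pose Y := if over y then e2 else if over z then kei a1 e2 else b1.
pose Z := if over z then a2 else if over x then kei b1 a2 else e1.
have [new] := assign 0%R
  (cs := [:: a1; a2; b1; b2; e1; e2; X; Z; Y; X; Z; Y]) uD' erefl.
move=> [ny3 nz2 nz3 nx2 nx3 ny2 nx0 nx1 ny0 ny1 nz0 nz1]; exists new.
have colx := crossing_colors cC cx; have coly := crossing_colors cC cy.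
have colz := crossing_colors cC cz.
have := (cE x, cE y, cE z); rewrite ex ey ez => -[[cy1 cz1] cx1].
rewrite cx1 -/a1 -/a2 in colx; rewrite cy1 -/b1 -/b2 in coly.
rewrite cz1 -/e1 -/e2 in colz.
have [okx oky okz] : [/\
   if over x' then b2 = X /\ e1 = kei X Z else e1 = Z /\ X = kei Z b2,
   if over y' then e2 = Y /\ a1 = kei Y X else a1 = X /\ Y = kei X e2 &
   if over z' then a2 = Z /\ b1 = kei Z Y else b1 = Y /\ Z = kei Y a2].
  move: not3 colx coly colz; rewrite ox oy oz /X /Y /Z.
  clearbody a1 a2 b1 b2 e1 e2; clear.
  move: (c x) (c y) (c z) => x0 y0 z0.
  case: (over x); case: (over y); case: (over z) => //= _ [? ?] [? ?] [? ?]; subst;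
    by rewrite ?kei_conj ?keiK.
have [vx0 vx1 vx2 vx3] : [/\ vertex_ok new x', vertex_ok new (node x'),
    vertex_ok new (node (node x')) & vertex_ok new (node (node (node x')))].
  by apply: crossing_vertex_if; rewrite // nx0 nx1 nx2 nx3.
have [vy0 vy1 vy2 vy3] : [/\ vertex_ok new y', vertex_ok new (node y'),
    vertex_ok new (node (node y')) & vertex_ok new (node (node (node y')))].
  by apply: crossing_vertex_if; rewrite // ny0 ny1 ny2 ny3.
have [vz0 vz1 vz2 vz3] : [/\ vertex_ok new z', vertex_ok new (node z'),
    vertex_ok new (node (node z')) & vertex_ok new (node (node (node z')))].
  by apply: crossing_vertex_if; rewrite // nz0 nz1 nz2 nz3.
split.
- by rewrite /= ny3 nz2 nz3 nx2 nx3 ny2.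
- move=> d; rewrite !inE; do ?[case/predU1P=> [->|]]; last move/eqP->;
  by rewrite ?ex' ?ey' ?ez' ?exn ?eyn ?ezn ?nx0 ?nx1 ?ny0 ?ny1 ?nz0 ?nz1.
- by move=> d; rewrite !inE; do ?[case/predU1P=> [->|]]; last move/eqP->.
Qed.

Lemma only_constant_move D D' : reidemeister_move D D' ->
  only_constant V D <-> only_constant V D'.
Proof.
case=> [[iso|sub]|r1|r2|r3].
- exact: isomorphic_only_constant iso.
- exact: subdivides_only_constant sub.
- exact: reidemeister1_only_constant r1.
- exact: reidemeister2_only_constant r2.
- by split; apply: reidemeister3_half => //; apply: reidemeister3_sym.
Qed.

Lemma only_constant_same_link D D' : same_link D D' ->
  only_constant V D <-> only_constant V D'.
Proof.
elim=> [{}D {}D'|{}D|{}D {}D' _ IH|D1 D2 D3 _ IH12 _ IH23] //.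
- exact: only_constant_move.
- by case: IH; split.
- by case: IH12; case: IH23 => *; split; auto.
Qed.

Lemma trivial_knot_only_constant D : trivial_knot D -> only_constant V D.
Proof.
case=> U [/only_constant_same_link DU conn markU]; apply/DU=> c [cE cV] x y.
apply/asboolP; apply: (connected_ind (P := fun y => `[< c x = c y >]) conn (x := x)).
- exact/asboolP.
- by move=> u /asboolP xu; apply/asboolP; rewrite cE.
- by move=> u /asboolP xu; apply/asboolP; rewrite (cV u).1.
Qed.

End Move3.

(** * Arcs of prime diagrams and of connected sums *)

Import GRing.Theory.

Lemma class_by_unit (V : zmodType) (a u v : V) :
  class_by (fun _ : unit => a) u = class_by (fun _ : unit => a) v ->
  exists k, (u - v = a *~ k)%R.
Proof.
case/class_byE=> k ->; exists (k tt).
by rewrite (bigD1 tt) //= big1 ?addr0 //; case.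
Qed.

Section ColGroup.
Variable D : diagram.
Local Open Scope ring_scope.

Lemma arcP (A : Arc D) : exists d, A = arc_at d.
Proof.
case: A => A A_in; have [d _ eA] := imsetP A_in.
by exists d; apply: val_inj.
Qed.

Lemma Col_gen_coloring : dart_coloring (fun d : D => Col_gen (arc_at d)).
Proof.
split=> [d|d]; first by rewrite -(arc_at_segment (segment_edge d)).
split=> [md|od]; first by rewrite -(arc_at_segment (segment_node md)).
split; first by rewrite arc_at_over.
pose r := @crossing_relation D; pose n d := arc_gen (arc_at (D := D) d).
transitivity (class_by r (n d *+ 2 - n (node d))); last first.
  by rewrite /class_by raddfB raddfMn.
apply/class_byE; exists (fun i => - (i == exist _ d od)%:R).
rewrite (bigD1 (exist _ d od)) //= eqxx big1 => [|i /negbTE->]; last first.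
  by rewrite oppr0 mulr0z.
by rewrite addr0 mulrNz mulr1z /crossing_relation /= [RHS]opprB.
Qed.

(** The arcs of a diagram are the universal coloring: any other one is a linear
    function of them that kills the relations. *)
Lemma coloring_extends (V : zmodType) (c : D -> V) : dart_coloring c ->
  exists Phi : {additive {ffun Arc D -> int} -> V},
    (forall d, Phi (arc_gen (arc_at d)) = c d) /\
    (forall u v, class_by (@crossing_relation D) u
                 = class_by (@crossing_relation D) v -> Phi u = Phi v).
Proof.
move=> [cE cV]; pose C A := odflt 0 (omap c [pick d | arc_at d == A]).
have c_along u v : connect (@along_arc D) u v -> c u = c v.
  move=> uv; apply: (connect_ind (P := fun v => c u = c v)) uv => // {}v w uv.
  case/or3P=> [/eqP->|/andP[mv /eqP->]|/andP[ov /eqP->]].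
  - by rewrite cE.
  - by rewrite (cV v).1.
  - by have [-> _] := (cV v).2 ov.
have CE d : C (arc_at d) = c d.
  rewrite /C; case: pickP => [u|/(_ d)] /=; last by rewrite eqxx.
  by rewrite arc_atE => /c_along.
pose phi (v : {ffun Arc D -> int}) := \sum_A C A *~ v A.
have phiB : zmod_morphism phi.
  move=> u v; rewrite /phi -sumrB; apply: eq_bigr => A _.
  by rewrite !ffunE mulrzBr.
pose Phi : {additive {ffun Arc D -> int} -> V} :=
  HB.pack phi (GRing.isZmodMorphism.Build _ _ phi phiB).
exists Phi; have gen d : Phi (arc_gen (arc_at d)) = c d.
  rewrite /= /phi (bigD1 (arc_at d)) //= ffunE eqxx CE big1 ?addr0 // => A Ad.
  by rewrite ffunE (negbTE Ad) mulr0z.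
move: (Phi : {additive _ -> _}) gen => {}Phi gen; split=> // u v /class_byE[k eq_k].
have Phi_kei r s t : Phi t = kei (Phi r) (Phi s) -> Phi (r *+ 2 - s - t) = 0.
  by move=> tE; rewrite 2!raddfB raddfMn tE /kei subrr.
have rel d : over d -> Phi (arc_gen (arc_at d) *+ 2 - arc_gen (arc_at (node d))
    - arc_gen (arc_at (node (node (node d))))) = 0.
  move=> od; have [_ c3] := (cV d).2 od; apply: Phi_kei.
  exact: etrans (gen _) (etrans c3 (esym (f_equal2 _ (gen _) (gen _)))).
apply/eqP; rewrite -subr_eq0 -raddfB eq_k raddf_sum big1 // => i _.
by rewrite raddfMz [Phi _](rel (val i) (valP i)) mul0rz.
Qed.

Lemma coloring_factors (V : zmodType) (c : D -> V) x y :
  dart_coloring c -> Col_gen (arc_at x) = Col_gen (arc_at y) -> c x = c y.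
Proof.
case/coloring_extends=> Phi [gen eqPhi] /eqPhi eq_xy.
exact: etrans (esym (gen x)) (etrans eq_xy (gen y)).
Qed.

(** The constant colorings split off from the group of colorings: arcs that
    agree modulo one arc are equal, as the sum of coefficients shows. *)
Lemma Col_red_inj (a0 : Arc D) x y :
  class_by (fun _ : unit => Col_gen a0) (Col_gen (arc_at x))
  = class_by (fun _ : unit => Col_gen a0) (Col_gen (arc_at y)) ->
  Col_gen (arc_at x) = Col_gen (arc_at y).
Proof.
case/class_by_unit=> k; have [d0 ->] := arcP a0.
have one_coloring : dart_coloring (fun _ : D => 1 : int).
  by split=> // d; split=> // _; rewrite kei_idem.
have [Phi [gen eqPhi]] := coloring_extends one_coloring => eq_k.
have : Phi (arc_gen (arc_at x) - arc_gen (arc_at y))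
     = Phi (arc_gen (arc_at d0) *~ k).
  apply: eqPhi; rewrite /class_by raddfB raddfMz; exact: eq_k.
have coef0 u v w : Phi u = 1 -> Phi v = 1 -> Phi w = 1 ->
    Phi (u - v) = Phi (w *~ k) -> k = 0.
  by rewrite raddfB raddfMz => -> -> ->; rewrite subrr mulrzz mul1r.
move=> /(coef0 _ _ _ (gen x) (gen y) (gen d0)) k0.
by apply: subr0_eq; rewrite eq_k k0 mulr0z.
Qed.

End ColGroup.

(** Two equal arcs would yield a cut of the diagram into a connected sum of two
    reduced alternating diagrams with crossings, and neither of these represents
    a trivial knot since both have nonconstant colorings. *)
Lemma prime_arcs_distinct (D : diagram) (x y : D) :
    reduced D -> alternating D -> prime_link D -> arc_at x != arc_at y ->
  Col_gen (arc_at x) <> Col_gen (arc_at y).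
Proof.
move=> red alt [nontriv nonsplit prime] xy.
have conn : connected D.
  apply: contrapT => nconn; apply: nonsplit; exists D; split; last exact/negP.
  exact: rst_refl.
have [d0 cd0] : exists d0 : D, crossing d0.
  apply: contrapT => no_c; apply: nontriv; exists D; split=> //.
    exact: rst_refl.
  by move=> d; apply/negP=> cd; apply: no_c; exists d.
have over_rep (z : D) : exists2 u, over u & arc_at u = arc_at z.
  have [d cd zd] := segment_crossing z conn cd0.
  rewrite (arc_at_segment zd); have [od|ud] := boolP (over d); first by exists d.
  exists (other d); first by rewrite over_other.
  by rewrite -(arc_at_segment (segment_other cd)).
have [u ou ux] := over_rep x; have [w ow wy] := over_rep y.
have xy' : arc_at x <> arc_at y by apply/eqP.
move=> /(balance_level conn alt)/(_ xy' ou ow ux wy)[T [TP uT wT outT]].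
have [S [p [p' [cS ST pS p'S]]]] := outs_cut conn alt TP uT outT.
have [A [f [a [sA connA]]]] := side_exists cS conn.
have [B [g [b [sB connB]]]] := side_exists (cutC cS) conn.
have nontrivial_side S' q q' (E : diagram) (h : E -> D) (e : E) (z : D) (c : bool) :
    cut S' q q' -> side_of S' q q' h e -> connected E ->
    z \in S' -> crossing z ->
    (forall z, z \in S' -> crossing z -> segment q z -> over z = c) ->
    (forall z, z \in S' -> crossing z -> segment q' z -> over z = ~~ c) ->
    ~ trivial_knot E.
  move=> cS' sE connE zS' cz qc q'c trivE.
  have [z' zz'] : exists z', z = h z'.
    by apply/codomP; rewrite (side_codom sE).
  have cz' : crossing z' by rewrite -(side_crossing sE) -zz'.
  have altE := side_alternating sE alt qc q'c.
  have redE := side_reduced cS' sE conn red.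
  have [s [t]] := alternating_nontrivial connE altE redE cz'; apply.
  exact: trivial_knot_only_constant trivE _ (@Col_gen_coloring E) s t.
have cu := over_is_crossing ou; have cw := over_is_crossing ow.
have := prime A B D f g a b (rst_refl _ _ _) (joins_sides sA sB); case.
  apply: (nontrivial_side S p p' A f a u true) => //; first by rewrite ST.
    by move=> z zS cz /(pS z cz) ->.
  by move=> z zS cz /(p'S z cz) ->; rewrite zS.
apply: (nontrivial_side (~: S) (edge p) (edge p') B g b w false) => //.
- exact: cutC.
- by rewrite inE ST.
- move=> z zS cz pz; rewrite (pS z cz); first by rewrite inE in zS; apply: negbTE.
  exact: segment_trans (segment_edge p) pz.
- move=> z zS cz pz; rewrite (p'S z cz); first by rewrite inE in zS.
  exact: segment_trans (segment_edge p') pz.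
Qed.

Section ConnectedSum.

(** Only one of the two arcs has to avoid [J].  This stronger form passes
    through connected sums: an arc in the other summand is compared with the
    cut edge, whose arc may belong to [J]. *)
Definition distinct_arcs (D : diagram) (J : {set D}) : Prop :=
  forall x y : D, (forall j, j \in J -> arc_at j != arc_at x) ->
    arc_at x != arc_at y -> Col_gen (arc_at x) <> Col_gen (arc_at y).

Lemma joins_sym (A B D : diagram) (f : A -> D) (g : B -> D) a b :
  joins f g a b -> joins g f b a.
Proof.
move=> [[f_inj g_inj] fg [nf ng] [ef eg] [ea ea']]; split=> //.
- by move=> d; rewrite fg negbK.
- by rewrite -ea -ea' !edgeK.
Qed.

Lemma joins_cases (A B D : diagram) (f : A -> D) (g : B -> D) a b d :
  joins f g a b -> (exists x, d = f x) \/ (exists y, d = g y).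
Proof.
case=> _ fg _ _ _; have [/codomP|] := boolP (d \in codom f); first by left.
by rewrite fg negbK => /codomP; right.
Qed.

(** Both strands of the connection carry the color of the cut edge, so that the
    other summand can be colored by this constant. *)
Lemma joins_extend (V : zmodType) (A B D : diagram) (f : A -> D) (g : B -> D) a b
    (cA : A -> V) : joins f g a b -> dart_coloring cA ->
  exists c : D -> V, [/\ dart_coloring c, forall x, c (f x) = cA x &
    forall y, c (g y) = cA a].
Proof.
move=> jn [cE cV]; have [[f_inj g_inj] fg [nf ng] [ef eg] [ea ea']] := jn.
pose c d := if [pick x | f x == d] is Some x then cA x else cA a.
have cf x : c (f x) = cA x.
  rewrite /c; case: pickP => [u /eqP/f_inj->|/(_ x)] //.
  by rewrite eqxx.
have cg y : c (g y) = cA a.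
  rewrite /c; case: pickP => // x /eqP fx; have := fg (f x).
  by rewrite codom_f fx codom_f.
have eb : edge (g b) = f a by rewrite -ea edgeK.
have eb' : edge (g (edge b)) = f (edge a) by rewrite -ea' edgeK.
exists c; split=> //; split=> d; have [[x ->]|[x ->]] := joins_cases d jn.
- have [->|xa] := eqVneq x a; first by rewrite ea cg cf.
  have [->|xa'] := eqVneq x (edge a); first by rewrite ea' cg cf cE.
  by rewrite ef ?cf ?cE // !inE negb_or xa.
- have [->|xb] := eqVneq x b; first by rewrite eb cf cg.
  have [->|xb'] := eqVneq x (edge b); first by rewrite eb' cf cg cE.
  by rewrite eg ?cg // !inE negb_or xb.
- have [n1 o1] := nf x; have [n2 _] := nf (node x); have [n3 _] := nf (node (node x)).
  rewrite /vertex_ok /crossing n1 n2 n3 o1 !cf (inj_eq f_inj); exact: cV.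
- have [n1 o1] := ng x; have [n2 _] := ng (node x); have [n3 _] := ng (node (node x)).
  by rewrite /vertex_ok n1 n2 n3 !cg kei_idem.
Qed.

(** Seen from [A], the summand [B] is the cut edge [a]: an arc of [A] avoiding
    this edge is separated from [d] as soon as a coloring of [A] separates it
    from [d], or from [a] if [d] lies in [B]. *)
Lemma joins_distinct (A B D : diagram) (f : A -> D) (g : B -> D) a b
    (JA : {set A}) (x : A) (d : D) :
    joins f g a b -> distinct_arcs JA ->
    (forall j, j \in JA -> arc_at (f j) != arc_at (f x)) ->
    arc_at (f a) != arc_at (f x) -> arc_at (f (edge a)) != arc_at (f x) ->
    arc_at (f x) != arc_at d ->
  Col_gen (arc_at (f x)) <> Col_gen (arc_at d).
Proof.
move=> jn IH nJ na na' xd.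
have [[f_inj g_inj] fg [nf ng] [ef eg] _] := jn.
have arc_f z : arc_at z == arc_at x -> arc_at (f x) == arc_at (f z).
  rewrite eq_sym arc_atE => xz.
  apply: (connect_ind (P := fun z => arc_at (f x) == arc_at (f z))) xz => //.
  move=> u v /eqP xu uv; have [nu ou] := nf u.
  have cu : crossing (f u) = crossing u.
    by rewrite /crossing nu; have [-> _] := nf (node u); rewrite (inj_eq f_inj).
  rewrite xu; case/or3P: uv => [/eqP->|/andP[mu /eqP->]|/andP[ov /eqP->]].
  - rewrite -ef; first by rewrite (arc_at_segment (segment_edge (f u))).
    rewrite !inE negb_or; apply/andP; split.
      by apply: contraNneq na => <-; rewrite xu.
    by apply: contraNneq na' => <-; rewrite xu.
  - by rewrite -nu -(arc_at_segment (segment_node _)) // cu.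
  - have [<- _] := nf (node u); rewrite -nu arc_at_over ?ou //.
have nJA j : j \in JA -> arc_at j != arc_at x.
  by move/nJ; apply: contra => /arc_f; rewrite eq_sym.
have separate t : arc_at x != arc_at t ->
    (forall (V : zmodType) (c : D -> V) (cA : A -> V),
       (forall z, c (f z) = cA z) -> (forall y, c (g y) = cA a) ->
       c d = cA t) ->
    Col_gen (arc_at (f x)) <> Col_gen (arc_at d).
  move=> xt dt eq_xd; apply: (IH x t nJA xt).
  have [c [cC cf cg]] := joins_extend jn (@Col_gen_coloring A).
  have := coloring_factors cC eq_xd; rewrite cf.
  by rewrite (dt _ c (fun z => Col_gen (arc_at z)) cf cg).
have [[t dt]|[y dy]] := joins_cases d jn.
  apply: (separate t) => [|V c cA cf _]; last by rewrite dt.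
  by apply: contra xd => xt; rewrite dt arc_f // eq_sym.
apply: (separate a) => [|V c cA _ cg]; last by rewrite dy.
by apply: contra na => xa; rewrite eq_sym arc_f // eq_sym.
Qed.

Lemma sum_arcs_distinct (D : diagram) (Ds : seq diagram) (J : {set D}) :
    connected_sum Ds J ->
    List.Forall (fun Di => reduced Di /\ alternating Di /\ prime_link Di) Ds ->
  distinct_arcs J.
Proof.
elim=> {D Ds J} [D|A B D As Bs JA JB f g a b _ IHA _ IHB jn].
  move=> D_prime; have [red [alt prime]] := List.Forall_inv D_prime.
  move=> x y _.
  exact: prime_arcs_distinct.
move=> /List.Forall_app[/IHA{}IHA /IHB{}IHB] d d' nJ dd'.
have inJ z : [|| z \in f @: JA, z \in g @: JB |
    z \in [:: f a; g b; f (edge a); g (edge b)]] -> arc_at z != arc_at d.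
  by move=> zJ; apply: nJ; rewrite !inE -!orbA in zJ *.
have [[x dx]|[x dx]] := joins_cases d jn; subst d.
  apply: (joins_distinct jn IHA _ _ _ dd') => [j jA||]; apply: inJ.
  - by rewrite imset_f.
  - by rewrite !inE eqxx !orbT.
  - by rewrite !inE eqxx !orbT.
apply: (joins_distinct (joins_sym jn) IHB _ _ _ dd') => [j jB||]; apply: inJ.
- by rewrite (imset_f g jB) orbT.
- by rewrite !inE eqxx !orbT.
- by rewrite !inE eqxx !orbT.
Qed.

End ConnectedSum.

(** * Coordinates in the reduced group of colorings *)

Import GRing.Theory.

Section Coordinates.

(** The coordinates as numbers, so that all the components of the sum have
    values of the same type. *)
Fixpoint coord (ns : seq nat) : cyclic_sum ns -> nat -> nat :=
  if ns is n :: ns' then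
    fun x i => if i is i'.+1 then coord x.2 i' else nat_of_ord x.1
  else fun _ _ => 0.

Lemma coord_lt ns (x : cyclic_sum ns) i : all (fun n => 1 < n) ns ->
  i < size ns -> coord x i < nth 1 ns i.
Proof.
elim: ns x i => // n ns IHns x [|i] /= /andP[n1 ns1]; last exact: IHns.
by move=> _; apply: leq_trans (ltn_ord x.1) _; rewrite Zp_cast.
Qed.

Lemma coordD ns (x y : cyclic_sum ns) i : all (fun n => 1 < n) ns ->
  i < size ns -> coord (x + y)%R i = coord x i + coord y i %[mod nth 1 ns i].
Proof.
elim: ns x y i => // n ns IHns x y [|i] /= /andP[n1 ns1]; last exact: IHns.
move=> _; have xy : nat_of_ord (x.1 + y.1)%R = (x.1 + y.1) %% n.
  by congr (_ %% _); apply: Zp_cast.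
exact: etrans (f_equal (modn^~ n) xy) (modn_mod _ _).
Qed.

Lemma coord_inj ns (x y : cyclic_sum ns) :
  (forall i, i < size ns -> coord x i = coord y i) -> x = y.
Proof.
elim: ns x y => [x y _|n ns IHns [x1 x2] [y1 y2] xy]; first by rewrite (ord1 x) (ord1 y).
congr pair; first exact/val_inj/(xy 0).
by apply: IHns => i; apply: (xy i.+1).
Qed.

Lemma dvdn_head ns i : sorted (fun m n => n %| m) ns -> i < size ns ->
  nth 1 ns i %| head 1 ns.
Proof.
case: ns i => // n ns [|i] //= ns_sorted i_lt.
have tr : transitive (fun m n => n %| m) by move=> a b c ba cb; apply: dvdn_trans cb ba.
by have /(all_nthP 1)/(_ i i_lt) := order_path_min tr ns_sorted.
Qed.

End Coordinates.

Theorem theorem4p2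
  (D : diagram) (Ds : seq diagram) (J : {set D})
  (D_sum : connected_sum Ds J)
  (Ds_prime : List.Forall
     (fun Di => reduced Di /\ alternating Di /\ prime_link Di) Ds)
  (a0 : Arc D) (ns : seq nat)
  (ns_dvd : sorted (fun m n => n %| m) ns)
  (ns_gt1 : all (fun n => 1 < n) ns)
  (Col_ns : group_isomorphic (Col_red a0) (cyclic_sum ns)) :
  let n1 := head 1 ns in
  (forall a b : Arc D, a != b -> ~~ joining_arc J a -> ~~ joining_arc J b ->
     exists f : Arc D -> 'I_n1, fox_coloring f /\ f a != f b)
  /\
  (exists t : nat, t <= size ns /\
     exists F : 'I_t -> Arc D -> 'I_n1,
       (forall i, fox_coloring (F i)) /\
       (forall a b : Arc D,
          a != b -> ~~ joining_arc J a -> ~~ joining_arc J b ->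
          exists i, F i a != F i b)).
Proof.
move=> n1; suff b_part : exists t : nat, t <= size ns /\
     exists F : 'I_t -> Arc D -> 'I_n1,
       (forall i, fox_coloring (F i)) /\
       (forall a b : Arc D,
          a != b -> ~~ joining_arc J a -> ~~ joining_arc J b ->
          exists i, F i a != F i b).
  split=> // a b ab aJ bJ; have [t [_ [F [F_fox F_sep]]]] := b_part.
  by have [i Fi] := F_sep a b ab aJ bJ; exists (F i).
have [phi phi_bij] := Col_ns.
pose g (A : Arc D) : cyclic_sum ns :=
  phi (class_by (fun _ : unit => Col_gen a0) (Col_gen A)).
have g_inj x y : g (arc_at x) = g (arc_at y) ->
    Col_gen (arc_at x) = Col_gen (arc_at y).
  by move/(bij_inj phi_bij)/Col_red_inj.
have g_fox d : over d ->
    (g (arc_at d) + g (arc_at d)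
     = g (arc_at (node d)) + g (arc_at (node (node (node d)))))%R.
  move=> od; have [_ col3] := ((Col_gen_coloring D).2 d).2 od.
  have kei_sum (V W : zmodType) (h : {additive V -> W}) (u v w : V) :
      w = kei u v -> (h u + h u = h v + h w)%R.
    by move=> ->; rewrite /kei mulr2n raddfB raddfD [RHS]addrC subrK.
  by apply: kei_sum; rewrite col3 /kei /class_by raddfB raddfMn.
(* the i-th coordinate, in Z / ni, is embedded in Z / n1 by this factor *)
pose scale i := n1 %/ nth 1 ns i.
have n1E i : i < size ns -> n1 = scale i * nth 1 ns i.
  by move=> i_lt; rewrite divnK // dvdn_head.
have n1_gt0 : 0 < n1.
  by rewrite /n1; case: (ns) ns_gt1 => //= n ns' /andP[/ltnW].
clearbody scale; have F_lt (i : 'I_(size ns)) A : scale i * coord (g A) i < n1.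
  rewrite (n1E i) // ltn_pmul2l ?coord_lt //.
  by move: n1_gt0; rewrite (n1E i) // muln_gt0 => /andP[].
pose F (i : 'I_(size ns)) A : 'I_n1 := Ordinal (F_lt i A).
exists (size ns); split=> //; exists F; split=> [i d od|a b ab aJ bJ].
  have scale_mod u : scale i * u = scale i * (u %% nth 1 ns i) %[mod n1].
    by rewrite (n1E i) // -!muln_modr modn_mod.
  have sum2 (u v w z : cyclic_sum ns) : (u + v = w + z)%R ->
      scale i * coord u i + scale i * coord v i
      = scale i * coord w i + scale i * coord z i %[mod n1].
    move=> uv; rewrite -!mulnDr scale_mod [RHS]scale_mod.
    by rewrite -!(coordD _ _ ns_gt1 (ltn_ord i)) uv.
  by have := sum2 _ _ _ _ (g_fox d od); rewrite /= mul2n -addnn.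
have [x ax] := arcP a; have [y by_] := arcP b.
have xJ j : j \in J -> arc_at j != arc_at x.
  move=> jJ; apply: contra aJ => /eqP jx; apply/existsP; exists j.
  by rewrite jJ ax jx eqxx.
have xy : arc_at x != arc_at y by rewrite -ax -by_.
have sep := sum_arcs_distinct D_sum Ds_prime xJ xy.
have [/existsP[i Fi]|no_i] := boolP [exists i, F i a != F i b]; first by exists i.
case: sep; apply: g_inj; apply: coord_inj => i i_lt.
move: no_i; rewrite negb_exists => /forallP/(_ (Ordinal i_lt)).
rewrite negbK -val_eqE /= eqn_pmul2l ?ax ?by_ => [/eqP//|].
by move: n1_gt0; rewrite (n1E i) // muln_gt0 => /andP[].
Qed.
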